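(* Let $n\in\mathbb{N}=\{1,2,\dots\}$ and let $\{E_m\}_{m\ge 0}$ be the $SU(2)$-equivariant subproduct system of the irreducible representation $\rho_n$ described in the context. Then for all $k,l\in\mathbb{N}_0$ there exists an $SU(2)$-equivariant unitary isomorphism \[E_k\otimes E_l\;\cong\;E_{k+l}\oplus E_{k+l-2}\oplus\dots\oplus E_{|k-l|},\] where $SU(2)$ acts on $E_k\otimes E_l$ diagonally.
   Context: Let $f_0,f_1$ be the standard basis of $\mathbb{C}^2$ and $\rho:SU(2)\to U(\mathbb{C}^2)$ the fundamental representation. For $n\in\mathbb{N}$ let $L_n\subseteq(\mathbb{C}^2)^{\otimes n}$ be the subspace of symmetric tensors (vectors fixed by all permutations of the tensor factors) and $\rho_n:SU(2)\to U(L_n)$ the irreducible representation obtained by restricting $\rho^{\otimes n}$. Define $\det(\rho_n,L_n)=\{\xi\in L_n\otimes L_n:(\rho_n(g)\otimes\rho_n(g))\xi=\xi\ \forall g\in SU(2)\}$. For $m\ge2$ put $K_m=\sum_{i=1}^{m-1}L_n^{\otimes(i-1)}\otimes\det(\rho_n,L_n)\otimes L_n^{\otimes(m-i-1)}\subseteq L_n^{\otimes m}$ and $E_m=K_m^\perp\subseteq L_n^{\otimes m}$; put $E_1=L_n$, $E_0=\mathbb{C}$. Each $E_m$ is invariant under $\rho_n^{\otimes m}$ (trivial action on $E_0$), which gives the $SU(2)$-action on $E_m$. *)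

(* Defs.v *)
From HB Require Import structures.
From mathcomp Require Import all_boot all_order all_algebra perm.
From mathcomp Require Import complex.
From mathcomp Require Import reals.
Set Implicit Arguments. Unset Strict Implicit. Unset Printing Implicit Defensive.
Import Order.TTheory GRing.Theory Num.Theory.
Local Open Scope ring_scope.

Section SubproductSystem.
Variable R : realType.
Local Notation C := (complex R).

(* A tensor product of copies of C^2 whose tensor factors are labelled by the
   finite set A of "positions": a vector is a function of the basis
   f_{t(a)} (a in A), t : A -> {0,1}.  *)
Definition sp (A : finType) := {ffun {ffun A -> 'I_2} -> C}.

Definition scl (A : finType) (c : C) (x : sp A) : sp A := [ffun t : {ffun A -> 'I_2} => c * x t].

Definition dot (A : finType) (x y : sp A) : C := \sum_(t : {ffun A -> 'I_2}) x t * conjc (y t).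

Definition inspan (A : finType) (P : sp A -> Prop) (x : sp A) : Prop :=
  exists s : seq (C * sp A),
    (forall p, p \in s -> P p.2) /\ x = \sum_(p <- s) scl p.1 p.2.

Definition SU2 (g : 'M[C]_2) : Prop :=
  g *m (map_mx conjc g)^T = 1%:M /\ \det g = 1.

(* the diagonal action rho^{(x) A}(g) of g on (C^2)^{(x) A} *)
Definition tact (A : finType) (g : 'M[C]_2) (x : sp A) : sp A :=
  [ffun t : {ffun A -> 'I_2} => \sum_(s : {ffun A -> 'I_2}) (\prod_a g (t a) (s a)) * x s].

Variable n : nat.

Definition permute (s : 'S_n) (x : sp 'I_n) : sp 'I_n :=
  [ffun t : {ffun 'I_n -> 'I_2} => x [ffun i => t (s i)]].
Definition Ln (x : sp 'I_n) : Prop := forall s : 'S_n, permute s x = x.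

(* (C^2)^{(x) n} ^{(x) m} : positions 'I_m * 'I_n (factor a, slot i) *)
Definition pos (m : nat) : finType := ('I_m * 'I_n)%type.

Definition etens (m : nat) (vs : 'I_m -> sp 'I_n) : sp (pos m) :=
  [ffun t : {ffun pos m -> 'I_2} => \prod_a vs a [ffun i => t (a, i)]].

Definition Lpow (m : nat) : sp (pos m) -> Prop :=
  inspan (fun x => exists vs : 'I_m -> sp 'I_n,
                     (forall a, Ln (vs a)) /\ x = etens vs).

Definition detL (xi : sp (pos 2)) : Prop :=
  Lpow xi /\ forall g, SU2 g -> tact g xi = xi.

(* v_0 (x) ... (x) v_{i-1} (x) xi (x) v_{i+2} (x) ... , xi in factors i, j = i+1 *)
Definition ins2 (m : nat) (i j : 'I_m) (xi : sp (pos 2)) (vs : 'I_m -> sp 'I_n)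
  : sp (pos m) :=
  [ffun t : {ffun pos m -> 'I_2} => xi [ffun p : pos 2 => t (if val p.1 == 0%N then i else j, p.2)] *
             \prod_(a | (a != i) && (a != j)) vs a [ffun k => t (a, k)]].

(* K_m = sum_i L^{(x)(i-1)} (x) det (x) L^{(x)(m-i-1)}  (empty sum, i.e. 0, if m < 2) *)
Definition Kpow (m : nat) : sp (pos m) -> Prop :=
  inspan (fun x => exists (i j : 'I_m) (xi : sp (pos 2)) (vs : 'I_m -> sp 'I_n),
     [/\ val j = (val i).+1, detL xi, (forall a, Ln (vs a)) & x = ins2 i j xi vs]).

(* E_m = K_m^perp inside L_n^{(x) m}; this gives E_0 = C and E_1 = L_n *)
Definition E (m : nat) (x : sp (pos m)) : Prop :=
  Lpow x /\ forall y, Kpow y -> dot x y = 0.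

Definition tens (A B : finType) (u : sp A) (v : sp B) : sp (A + B)%type :=
  [ffun t : {ffun (A + B)%type -> 'I_2} => u [ffun a => t (inl a)] * v [ffun b => t (inr b)]].

Definition EE (k l : nat) : sp (pos k + pos l)%type -> Prop :=
  inspan (fun x => exists u v, [/\ E u, E v & x = tens u v]).

End SubproductSystem.

(* Main.v *)
Require Import Defs.
From HB Require Import structures.
From mathcomp Require Import all_boot all_order all_algebra perm.
From mathcomp Require Import complex.
From mathcomp Require Import reals boolp ring zify.
Set Implicit Arguments. Unset Strict Implicit. Unset Printing Implicit Defensive.
Import Order.TTheory GRing.Theory Num.Theory.
Local Open Scope ring_scope.

(* The space det(rho_n, L_n) is a line spanned by a vector delta satisfying the
   zigzag equations, so E_m is the range of a Jones-Wenzl projection for the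
   loop value N = n + 1 >= 2.  Contracting the two letters at the junction of
   E_k (x) E_l with delta gives c : E_k (x) E_l -> E_{k-1} (x) E_{l-1} with kernel
   E_{k+l}, and Wenzl's recursion yields
     c c* = (N - rho_k - rho_l) + rho_k rho_l c* c,   0 <= rho_k, rho_l < 1.
   Hence c c* is a positive scalar on each space (c* )^j E_{k+l-2j}, and the maps
   (c* )^j, suitably normalised, embed the E_{k+l-2j} isometrically, with
   orthogonal ranges that exhaust E_k (x) E_l.
   Equivariance holds because delta is invariant.

   Concretely, L_n gets the unnormalised weight basis indexed by 'I_n.+1 (the
   weight counts the indices equal to 1), with squared norms 'C(n, a), and tensors
   are functions of words in the weights.  Operators act on all lengths at once. *)

(** Exhaustion is proved by induction along the contraction, with no characters and no dimension
    count: once [cap2 X] is known to be a sum of towers, a combination of the same towers raised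
    once more has the same contraction, and the difference from [X], killed by c, lies in E_{k+l}.
    This requires dividing by the scalars of c c*, and their positivity comes from N >= 2: with
    rho_0 = 0 and rho_{k+1} = 1 / (N - rho_k), every rho_k stays in [0, 1[, so N - rho_k - rho_l >
    0. The unnormalised basis keeps the coefficients rational: delta has coefficients (-1)^a / 'C(n,
    a), and the cap, its adjoint for the weighted inner product, has (-1)^a 'C(n, a). Square roots
    enter only in the final normalisation. Functions on words of every length spare the recursions
    any dependent types. The price is that equalities are stated for words of given sizes, or that a
    tensor gets the value 0 on the other lengths. *)

Section Words.
Variables (K : numClosedFieldType) (n : nat).
Local Notation I := 'I_n.+1.
Local Notation tensor := (seq I -> K).
Implicit Types (a b : I) (u v w : seq I) (X Y Z : tensor) (k : nat).

(** * Coefficients of the cup and the cap *)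

Definition bar (a : I) : I := rev_ord a.
Definition mass (a : I) : K := 'C(n, a)%:R.
Definition cap_coef (a : I) : K := (-1) ^+ a * mass a.
Definition cup_coef (a : I) : K := (-1) ^+ a / mass a.
Local Notation m := mass.
Local Notation s := cap_coef.
Local Notation q := cup_coef.
Local Notation N := (n.+1%:R : K).

Lemma barK : involutive bar.
Proof. exact: rev_ordK. Qed.

Lemma mass_gt0 a : 0 < m a.
Proof. by rewrite ltr0n bin_gt0 -ltnS. Qed.

Lemma mass_neq0 a : m a != 0.
Proof. by rewrite gt_eqF ?mass_gt0. Qed.

Lemma mass_bar a : m (bar a) = m a.
Proof. by rewrite /m /= subSS bin_sub // -ltnS. Qed.

Lemma cap_cup a : s a * q a = 1.
Proof.
by rewrite mulrACA mulfV ?mass_neq0 // mulr1 -exprMn mulrNN mulr1 expr1n.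
Qed.

(** Exchanging the two letters changes the invariant form only by the sign (-1)^n, so contracting in
    either order has the same kernel. *)
Lemma cap_bar a : s (bar a) = (-1) ^+ n * s a.
Proof.
rewrite /s mass_bar mulrA -exprD /= subSS; congr (_ * _).
have an : (a <= n)%N by rewrite -ltnS.
by rewrite -signr_odd oddB // -[RHS]signr_odd oddD.
Qed.

Lemma conj_cap a : (s a)^* = s a.
Proof. by rewrite rmorphM rmorphXn rmorphN1 /= /mass conjC_nat. Qed.

Lemma conj_cup a : (q a)^* = q a.
Proof. by rewrite rmorphM rmorphXn rmorphN1 fmorphV /= /mass conjC_nat. Qed.

(** This makes [cap] the adjoint of [cup]: pairing with delta weighs the letters a and [bar a] by
    their squared norms. *)
Lemma mass_cup a : m a * m (bar a) * q a = s a.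
Proof.
by rewrite mass_bar mulrCA -mulrA mulfV ?mass_neq0 // mulr1.
Qed.

Lemma sum_bar (F : I -> K) : \sum_a F (bar a) = \sum_a F a.
Proof. by rewrite [RHS](reindex_inj (inv_inj barK)). Qed.

Lemma sum_pick a (F : I -> K) : \sum_b (b == a)%:R * F b = F a.
Proof.
rewrite (bigD1 a) //= eqxx mul1r big1 ?addr0 // => b /negbTE->.
by rewrite mul0r.
Qed.

(** * The Jones-Wenzl projection on words *)

Definition sub a X : tensor := fun w => X (a :: w).
Definition ins a X : tensor := fun w =>
  if w is b :: v then (b == a)%:R * X v else 0.
Definition cap X : tensor := fun w => \sum_a s a * X [:: a, bar a & w].
Definition cup X : tensor := fun w =>
  if w is a :: v then q a * ins (bar a) X v else 0.

(* The coefficient [k]_t / [k+1]_t of Wenzl's recursion, t + 1/t = n + 1. *)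
Fixpoint rho k : K := if k is k'.+1 then (N - rho k')^-1 else 0.

(** Wenzl's recursion p_{k+1} = 1 (x) p_k - rho_k (1 (x) p_k) cup cap (1 (x) p_k), with the new
    letter in front. The length is a separate argument because the inner projection is evaluated on
    words other than the tail of [w]. *)
Fixpoint jwn k X w : K :=
  match k, w with
  | k'.+1, a :: u =>
    let tl Z v := if v is b :: v' then jwn k' (sub b Z) v' else Z [::] in
    tl X w - rho k' * tl (cup (cap (tl X))) w
  | _, _ => X w
  end.

Definition jw X w := jwn (size w) X w.
Definition jw1 X w := if w is a :: u then jw (sub a X) u else X [::].

Lemma jwn_ext k X Y w : size w = k ->
  (forall v, size v = k -> X v = Y v) -> jwn k X w = jwn k Y w.
Proof.
elim: k X Y w => [|k IH] X Y [|a u] //= => [_ -> //|[su] XY].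
have sXY b v : size v = k -> jwn k (sub b X) v = jwn k (sub b Y) v.
  by move=> sv; apply: IH => // v' sv'; apply: XY; rewrite /= sv'.
congr (_ - _ * _); first exact: sXY.
apply: IH => // [[|b v]] //= sv; congr (_ * (_ * _)).
apply: eq_bigr => d _; congr (_ * _); exact: sXY.
Qed.

Lemma jw_ext X Y w : (forall v, size v = size w -> X v = Y v) -> jw X w = jw Y w.
Proof. exact: jwn_ext. Qed.

Lemma jw1_ext X Y w : (forall v, size v = size w -> X v = Y v) -> jw1 X w = jw1 Y w.
Proof.
case: w => [|a u] XY; first exact: XY.
by apply: jw_ext => v sv; apply: XY; rewrite /= sv.
Qed.

Lemma cup_ext X Y w :
  (forall v, (size v).+2 = size w -> X v = Y v) -> cup X w = cup Y w.
Proof. by case: w => [|a [|b w]] //= XY; rewrite XY. Qed.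

Lemma jw_rec X w :
  jw X w = jw1 X w - rho (size w).-1 * jw1 (cup (cap (jw1 X))) w.
Proof.
case: w => [|a u]; first by rewrite /jw /= mulr0 subr0.
rewrite /jw /=; congr (_ - _ * _).
apply: jw_ext => v sv; apply: cup_ext => v' [sv'].
apply: eq_bigr => b _; congr (_ * _).
by rewrite -[RHS]/(jwn (size v').+1 (sub b X) (bar b :: v')) sv' sv.
Qed.

Lemma jwn_lin k f X Y w :
  jwn k (fun v => f * X v + Y v) w = f * jwn k X w + jwn k Y w.
Proof.
elim: k f X Y w => [|k IH] f X Y [|a u] //.
pose tl Z v := if v is b :: v' then jwn k (sub b Z) v' else Z [::].
have tlD Z Z' v : tl (fun v => f * Z v + Z' v) v = f * tl Z v + tl Z' v.
  by case: v => //= b v; rewrite -IH.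
have jwnE Z : jwn k.+1 Z (a :: u) =
  tl Z (a :: u) - rho k * jwn k (sub a (cup (cap (tl Z)))) u by [].
rewrite !jwnE tlD (_ : sub a _ = fun v => f * sub a (cup (cap (tl X))) v
                              + sub a (cup (cap (tl Y))) v); last first.
  apply/funext => -[|b v]; rewrite /sub /=; first by ring.
  rewrite /cap; under eq_bigr do rewrite tlD mulrDr mulrCA.
  by rewrite big_split /= -mulr_sumr; ring.
by rewrite IH; ring.
Qed.

Lemma jw_lin f X Y w : jw (fun v => f * X v + Y v) w = f * jw X w + jw Y w.
Proof. exact: jwn_lin. Qed.

Lemma jw0 w : jw (fun=> 0) w = 0.
Proof.
rewrite -[RHS](addNr (jw (fun=> 0) w)) -mulN1r -jw_lin; congr jw.
by apply/funext => v; rewrite mulr0 addr0.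
Qed.

Lemma jwZ f X w : jw (fun v => f * X v) w = f * jw X w.
Proof.
rewrite -[RHS]addr0 -(jw0 w) -jw_lin; congr jw.
by apply/funext => v; rewrite addr0.
Qed.

Lemma jw_sum (T : Type) (r : seq T) (F : T -> tensor) w :
  jw (fun v => \sum_(i <- r) F i v) w = \sum_(i <- r) jw (F i) w.
Proof.
elim: r => [|i r IH].
  by rewrite big_nil -[RHS](jw0 w); congr jw; apply/funext => v; rewrite big_nil.
rewrite big_cons -IH -[X in _ = X + _]mul1r -jw_lin.
by congr jw; apply/funext => v; rewrite big_cons mul1r.
Qed.

(** E_k as the common kernel of the contractions at adjacent letters. The version of fixed length
    serves the induction on the length that follows. *)
Definition isEk k X := forall u v, (size u + (size v).+2 = k)%N ->
  \sum_a s a * X (u ++ [:: a, bar a & v]) = 0.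
Definition isE X := forall u v, \sum_a s a * X (u ++ [:: a, bar a & v]) = 0.

Lemma isEP X : isE X <-> forall k, isEk k X.
Proof.
split=> [EX k u v _|EX u v]; first exact: EX.
exact: (EX (size u + (size v).+2)%N).
Qed.

Lemma isEk_sum (T : Type) (r : seq T) (f : T -> K) (F : T -> tensor) k :
  (forall i, isEk k (F i)) -> isEk k (fun v => \sum_(i <- r) f i * F i v).
Proof.
move=> EF u v uv; under eq_bigr do rewrite mulr_sumr.
rewrite exchange_big big1 // => i _.
by under eq_bigr do rewrite mulrCA; rewrite -mulr_sumr EF // mulr0.
Qed.

Lemma isEk_lin f X Y k :
  isEk k X -> isEk k Y -> isEk k (fun v => f * X v + Y v).
Proof.
move=> EX EY u v uv; under eq_bigr do rewrite mulrDr mulrCA.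
by rewrite big_split /= -mulr_sumr EX // EY // mulr0 addr0.
Qed.

Lemma isEk_ext k X Y :
  (forall w, size w = k -> X w = Y w) -> isEk k X -> isEk k Y.
Proof.
move=> XY EX u v uv; rewrite -[RHS](EX u v uv).
by apply: eq_bigr => a _; rewrite XY // size_cat.
Qed.

Lemma isEk_cons k X : isEk k.+1 X <->
  (forall w, (size w).+1 = k -> cap X w = 0) /\ (forall a, isEk k (sub a X)).
Proof.
split=> [EX|[cX EX] [|a u] v [uv]].
- split=> [w wk|a u v uv]; first by apply: (EX [::]); rewrite /= -wk.
  by apply: (EX (a :: u)); rewrite /= -uv.
- exact: cX.
- exact: EX.
Qed.

Lemma cap_ext k X Y : (forall w, size w = k.+2 -> X w = Y w) ->
  forall w, size w = k -> cap X w = cap Y w.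
Proof. by move=> XY w wk; apply: eq_bigr => a _; rewrite XY //= wk. Qed.

Lemma jw10 w : jw1 (fun=> 0) w = 0.
Proof. by case: w => //= a w; exact: jw0. Qed.

Definition jw_at k := (forall X, isEk k (jw X)) /\
  (forall X, isEk k X -> forall w, size w = k -> jw X w = X w).

(** On e_a (x) Z with Z in E_k the projection applied first acts trivially, so that only the outer
    one of the correction term survives. *)
Lemma wenzl_at k : jw_at k -> forall a b Z w, size w = k -> isEk k Z ->
  jw (ins a Z) (b :: w) =
  (b == a)%:R * Z w - rho k * (q b * s a * jw (ins (bar b) (sub (bar a) Z)) w).
Proof.
move=> [_ fixk] a b Z w wk EZ.
have jZ d u : size u = k -> jw (sub d (ins a Z)) u = (d == a)%:R * Z u.
  by move=> uk; rewrite -[in RHS](fixk Z) // -jwZ.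
rewrite jw_rec /= jZ // wk; congr (_ - _ * _).
rewrite -mulrA -!jwZ; apply: jw_ext => -[|d u] du; first by rewrite /sub /= !mulr0.
have capE : cap (jw1 (ins a Z)) u = s a * Z (bar a :: u).
  rewrite -[in RHS](sum_pick a (fun e => s e * Z (bar e :: u))).
  by apply: eq_bigr => e _; rewrite /= jZ -?wk -?du; first exact: mulrCA.
by rewrite /sub /= capE; congr (_ * _); rewrite mulrCA.
Qed.

Lemma jw_split Z w : w != [::] -> \sum_a jw (ins a (sub a Z)) w = jw Z w.
Proof.
move=> w0; rewrite -jw_sum; apply: jw_ext => -[|b v] sv; last first.
  rewrite -[RHS](sum_pick b (fun a => Z (a :: v))).
  by apply: eq_bigr => a _ /=; rewrite eq_sym.
by case: w w0 sv.
Qed.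

(** The empty word has no first letter to split off; the factor rho_0 = 0 absorbs this case. *)
Lemma rho_split Z w (f : K) : (w != [::] -> jw Z w = f) ->
  \sum_a rho (size w) * jw (ins (bar a) (sub (bar a) Z)) w = rho (size w) * f.
Proof.
rewrite -mulr_sumr (sum_bar (fun a => jw (ins a (sub a Z)) w)).
by case: w => [|a w] Zf; rewrite ?mul0r // jw_split // Zf.
Qed.

(** The partial trace of p_{k+1} over its first factor. The leading term counts N letters; in the
    correction s_a q_a = 1, and the remaining sum reassembles Z. *)
Lemma trace_at k : jw_at k -> forall Z w, size w = k -> isEk k Z ->
  \sum_a jw (ins a Z) (a :: w) = (N - rho k) * Z w.
Proof.
move=> jk Z w wk EZ.
under eq_bigr do rewrite (wenzl_at jk) // eqxx mul1r (mulrC (cup_coef _)) cap_cup mul1r.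
rewrite big_split /= sumr_const card_ord sumrN -wk.
rewrite (@rho_split _ _ (Z w)) => [|_]; first by rewrite mulrBl mulr_natl.
by case: jk => _ ->.
Qed.

(** Contractions inside the tail are killed by the outer projection. At the front, [trace_at] gives
    Z - rho_{k+1} (N - rho_k) Z after a shift of k, and the recursion for [rho] is chosen to make
    this vanish. Vectors of E are fixed because the correction contains their contraction. *)
Lemma jw_atS k : (forall j, (j <= k)%N -> jw_at j) -> N - rho k.-1 != 0 -> jw_at k.+1.
Proof.
move=> IH rho0; have [Ek fixk] := IH k (leqnn k).
split=> [X|X /isEk_cons[cX EX] [|a w] // [wk]]; last first.
  rewrite jw_rec /= fixk // -[RHS]subr0; congr (_ - _).
  rewrite -[jw _ _]/(jw1 (cup (cap (jw1 X))) (a :: w)).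
  rewrite -[RHS](mulr0 (rho (size w))) -(jw10 (a :: w)); congr (_ * _).
  apply: jw1_ext => -[|b [|d v]] //= [dv]; rewrite ?mulr0 //.
  rewrite (@cap_ext (size v) _ X) ?cX ?mulr0 //; first by rewrite ?dv -?wk -?dv.
  by move=> [//|e u] [eu]; rewrite /= fixk // eu dv wk.
have EjX a : isEk k (sub a (jw X)).
  apply: (@isEk_ext _ (fun w => - rho k * jw (sub a (cup (cap (jw1 X)))) w + jw (sub a X) w)).
    by move=> w wk; rewrite [in RHS]/sub (jw_rec X) /= wk addrC mulNr.
  exact: isEk_lin.
apply/isEk_cons; split=> // w wk.
case: k => [//|k] in IH rho0 Ek fixk EjX wk *; move: wk => -[wk].
have EZ : isEk k (cap (jw1 X)).
  apply: isEk_sum => a u v uv.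
  have /isEk_cons[_ /(_ (bar a))] := Ek (sub a X).
  by apply.
set Z := cap (jw1 X) in EZ.
have -> : cap (jw X) w = Z w - rho k.+1 * cap (jw1 (cup Z)) w.
  rewrite {1}/cap; under eq_bigr do rewrite jw_rec /= wk mulrBr.
  rewrite sumrB; congr (_ - _); rewrite mulr_sumr.
  by apply: eq_bigr => a _; rewrite mulrCA.
have -> : cap (jw1 (cup Z)) w = (N - rho k) * Z w.
  rewrite -(trace_at (IH k _)) // -(sum_bar (fun a => jw (ins a Z) (a :: w))).
  by apply: eq_bigr => a _; rewrite /= jwZ mulrA cap_cup mul1r.
by rewrite mulrA /= mulVf ?mul1r ?subrr.
Qed.

Hypothesis n_gt0 : (0 < n)%N.

Lemma rho_bounds k : 0 <= rho k < 1.
Proof.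
elim: k => [|k /andP[r0 r1]] /=; first by rewrite lexx ltr01.
have r2 : 1 < N - rho k.
  rewrite ltrBrDr; apply: (@lt_le_trans _ _ (1 + 1)); first by rewrite ltrD2l.
  by rewrite -[1 + 1]/(2%:R) ler_nat ltnS.
by rewrite invr_ge0 (le_trans ler01 (ltW r2)) /= invf_lt1 // (lt_trans ltr01 r2).
Qed.

Lemma jw_at_all k : jw_at k.
Proof.
elim/ltn_ind: k => -[|k] IH.
  split=> [X u v|X _ [|a w] //]; first by rewrite addnS.
apply: jw_atS => [j jk|]; first exact: IH.
have /andP[r0 r1] := rho_bounds k.-1.
rewrite gt_eqF // subr_gt0 (lt_le_trans r1) //.
by rewrite ler1n.
Qed.

Lemma isE_jw X : isE (jw X).
Proof. by apply/isEP => k; case: (jw_at_all k). Qed.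

Lemma jw_id X : isE X -> jw X = X.
Proof.
move=> /isEP EX; apply/funext => w.
by case: (jw_at_all (size w)) => _; apply.
Qed.

Lemma wenzl a b Z w : isE Z -> jw (ins a Z) (b :: w) =
  (b == a)%:R * Z w
  - rho (size w) * (q b * s a * jw (ins (bar b) (sub (bar a) Z)) w).
Proof. by move=> /isEP EZ; apply: wenzl_at => //; exact: jw_at_all. Qed.

Lemma isE_sum (T : Type) (r : seq T) (f : T -> K) (F : T -> tensor) :
  (forall i, isE (F i)) -> isE (fun v => \sum_(i <- r) f i * F i v).
Proof.
by move=> EF; apply/isEP => k; apply: isEk_sum => i; apply/isEP: k.
Qed.

Lemma isE_sub a X : isE X -> isE (sub a X).
Proof. by move=> EX u v; exact: (EX (a :: u)). Qed.

Lemma isEZ f X : isE X -> isE (fun v => f * X v).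
Proof.
move=> EX u v; under eq_bigr do rewrite mulrCA.
by rewrite -mulr_sumr EX mulr0.
Qed.

End Words.

(** * Two tensor factors meeting at a junction *)

Section TwoSided.
Variables (K : numClosedFieldType) (n : nat).
Hypothesis n_gt0 : (0 < n)%N.
Local Notation I := 'I_n.+1.
Local Notation tensor := (seq I -> K).
Local Notation bitensor := (seq I -> seq I -> K).
Local Notation m := (@mass K n).
Local Notation s := (@cap_coef K n).
Local Notation q := (@cup_coef K n).
Local Notation N := (n.+1%:R : K).
Local Notation rho := (rho K n).
Implicit Types (a b d : I) (u v w : seq I) (X Y W : bitensor) (z : tensor).
Implicit Types (k l j : nat).

(* In [X u v] both words are read starting from the place where the two tensor
   factors meet, so [u] lists the letters of the left factor from right to left. *)
Definition jw2 X : bitensor := fun u v => jw (fun u' => jw (X u') v) u.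
Definition cap2 X : bitensor := fun u v =>
  \sum_a s a * X (a :: u) (bar a :: v).
Definition cup2 X : bitensor := fun u v =>
  if u is a :: u' then q a * ins (bar a) (X u') v else 0.
(** The map c*: inserting delta at the junction leaves E_k (x) E_l, and the projections on both
    sides lead back into it. *)
Definition raise X := jw2 (cup2 X).
Definition isE2 X := (forall v, isE (X^~ v)) /\ (forall u, isE (X u)).

Lemma isE0 : isE (fun=> 0 : K) (n := n).
Proof. by move=> u v; rewrite big1 // => a _; rewrite mulr0. Qed.

Lemma isE_lin f (Z Z' : tensor) : isE Z -> isE Z' -> isE (fun v => f * Z v + Z' v).
Proof.
by move=> /isEP EZ /isEP EZ'; apply/isEP => k; exact: isEk_lin.
Qed.

Lemma isE_param Z v : (forall v', isE (Z^~ v')) -> isE (fun u => jw (Z u) v : K) (n := n).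
Proof.
move=> EZ u1 u2; rewrite -[RHS](jw0 K v).
under eq_bigr do rewrite -jwZ.
by rewrite -jw_sum; congr jw; apply/funext => v'; exact: EZ.
Qed.

Lemma isE2_jw2 X : isE2 (jw2 X).
Proof.
split=> [v|u]; first exact: isE_jw.
move=> v1 v2; rewrite -[RHS](jw0 K u).
under eq_bigr do rewrite -jwZ.
by rewrite -jw_sum; congr jw; apply/funext => u'; exact: isE_jw.
Qed.

Lemma jw2_id X : isE2 X -> jw2 X = X.
Proof.
move=> [El Er]; apply/funext => u; apply/funext => v; rewrite /jw2.
by rewrite (_ : (fun u' => _) = X^~ v) ?jw_id //; apply/funext => u'; rewrite jw_id.
Qed.

Lemma isE2_cap2 X : isE2 X -> isE2 (cap2 X).
Proof.
move=> [El Er]; split=> [v|u].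
  apply: (@isE_sum _ _ _ _ s (fun a u => X (a :: u) (bar a :: v))) => a.
  exact: (isE_sub a (El (bar a :: v))).
apply: (@isE_sum _ _ _ _ s (fun a v => X (a :: u) (bar a :: v))) => a.
exact: isE_sub.
Qed.

Lemma jw_split0 (Z : tensor) w : Z [::] = 0 ->
  jw Z w = \sum_a jw (ins a (sub a Z)) w.
Proof.
case: w => [|a w] Z0; last by rewrite jw_split.
by rewrite [LHS]Z0 big1.
Qed.

Lemma jw_ins_lin a f (Z Z' : tensor) w :
  jw (ins a (fun v => f * Z v + Z' v)) w = f * jw (ins a Z) w + jw (ins a Z') w.
Proof.
rewrite -jw_lin; congr jw; apply/funext => -[|b v] /=; first by rewrite mulr0 addr0.
by rewrite mulrDr mulrCA.
Qed.

Lemma jw_cup2 Y u v :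
  jw (cup2 Y u) v = if u is d :: u' then q d * jw (ins (bar d) (Y u')) v else 0.
Proof. by case: u => [|d u]; [exact: jw0|exact: jwZ]. Qed.

Lemma raise_ext k l X Y : (forall u v, size u = k -> size v = l -> X u v = Y u v) ->
  forall u v, size u = k.+1 -> size v = l.+1 -> raise X u v = raise Y u v.
Proof.
move=> XY u v uk vl; apply: jw_ext => u' uu'; apply: jw_ext => v' vv'.
case: u' uu' => [//|a u'] /= uu'; case: v' vv' => [//|b v'] /= vv'.
have -> // : X u' v' = Y u' v'.
by apply: XY; apply: succn_inj; rewrite ?uu' ?vv'.
Qed.

Lemma raise_lin f X Y u v :
  raise (fun u v => f * X u v + Y u v) u v = f * raise X u v + raise Y u v.
Proof.
rewrite /raise /jw2 -jw_lin; congr jw; apply/funext => u'.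
rewrite -jw_lin; congr jw; apply/funext => v'.
case: u' v' => [|a u'] [|b v'] /=; rewrite ?mulr0 ?addr0 //; ring.
Qed.

Lemma raise0 u v : raise (fun _ _ => 0) u v = 0.
Proof.
rewrite -[RHS](addNr (raise (fun _ _ => 0) u v)) -mulN1r -raise_lin.
by congr (raise _ u v); apply/funext => u'; apply/funext => v'; rewrite mulr0 addr0.
Qed.

Lemma raiseZ f X u v : raise (fun u v => f * X u v) u v = f * raise X u v.
Proof.
rewrite -[RHS]addr0 -(raise0 u v) -raise_lin.
by congr (raise _ u v); apply/funext => u'; apply/funext => v'; rewrite addr0.
Qed.

Lemma raise_nil X u v : (u == [::]) || (v == [::]) -> raise X u v = 0.
Proof.
case: u => [_|a u /eqP->]; first exact: (jw0 K v).
rewrite -[RHS](jw0 K (a :: u)); congr jw; apply/funext => -[|b u'];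
  by rewrite jw_cup2 //= mulr0.
Qed.

Section CapRaise.
Variables (Y : bitensor) (EY : isE2 Y) (u v : seq I).
Let r := rho (size v).
(** [H] is the correction of Wenzl's formula in the right factor, and [F] is the full right factor,
    yet to be projected on the left. *)
Let H a d u' := jw (ins a (sub d (Y u'))) v.
Let F a d u' :=
  q d * (- (r * (q (bar a) * s (bar d))) * H a d u' + (a == d)%:R * Y u' v).

Let isE_F a d : isE (F a d).
Proof.
apply/isEZ/isE_lin; last by apply: isEZ; exact: EY.1.
apply: isE_param => -[|b v'] /=; first exact: isE0.
by apply: isEZ; exact: EY.1.
Qed.

Let raise_cons a : raise Y (a :: u) (bar a :: v) = \sum_d jw (ins d (F a d)) (a :: u).
Proof.
rewrite /raise /jw2 -(jw_split _ (w := a :: u)) //; apply: eq_bigr => d _.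
congr jw; apply/funext => -[|b u'] //=; congr (_ * _).
rewrite /sub jw_cup2 wenzl; [|exact: n_gt0|exact: EY.2].
by rewrite !barK (inj_eq (inv_inj (@barK n))) /F /H addrC mulNr mulrA.
Qed.

(** Wenzl's formula is applied on the right and then on the left. The product of the leading terms
    gives N, the two mixed products give -rho, and the product of the two corrections is again a
    projected cup, namely that of [cap2 Y]. *)
Lemma cap2_raise :
  cap2 (raise Y) u v =
  (N - rho (size u) - rho (size v)) * Y u v
  + rho (size u) * rho (size v) * raise (cap2 Y) u v.
Proof.
(* [G] carries the corrections of both factors. *)
pose G a d := jw (ins (bar a) (sub (bar d) (H a d))) u.
have raise_capE : raise (cap2 Y) u v = \sum_a \sum_d q (bar a) * s (bar d) * G a d.
  rewrite -(sum_bar (fun a => \sum_d _)) /raise /jw2 jw_split0; last by rewrite jw_cup2.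
  apply: eq_bigr => a _; rewrite -(sum_bar (fun d => _ * G _ d)).
  have -> : ins a (sub a (fun u' => jw (cup2 (cap2 Y) u') v)) = fun u' =>
      \sum_d q (bar (bar a)) * s (bar (bar d)) *
         ins (bar (bar a)) (sub (bar (bar d)) (H (bar a) (bar d))) u'.
    apply/funext => -[|b u'] /=; first by rewrite big1 // => d _; rewrite mulr0.
    rewrite !barK; under eq_bigr do rewrite barK mulrCA.
    rewrite -mulr_sumr; congr (_ * _); rewrite /sub jw_cup2.
    under eq_bigr do rewrite -mulrA; rewrite -mulr_sumr; congr (_ * _).
    under eq_bigr do rewrite /H -jwZ; rewrite -jw_sum; congr jw.
    apply/funext => -[|c v'] /=; first by rewrite big1 // => d _; rewrite mulr0.
    rewrite mulr_sumr; apply: eq_bigr => d _; rewrite mulrCA //.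
  by rewrite jw_sum; apply: eq_bigr => d _; rewrite jwZ.
(* [J] carries the correction on the left against the leading term on the right, which survives only
   for equal letters. *)
pose J a := jw (ins (bar a) (sub (bar a) (Y^~ v))) u.
have jwF a d : jw (ins (bar a) (sub (bar d) (F a d))) u =
    q d * (- (r * (q (bar a) * s (bar d))) * G a d + (d == a)%:R * J a).
  rewrite (_ : ins _ _ = fun u' => q d * ins (bar a) (fun u' =>
      - (r * (q (bar a) * s (bar d))) * sub (bar d) (H a d) u'
      + (d == a)%:R * sub (bar a) (Y^~ v) u') u'); last first.
    apply/funext => -[|b u'] /=; first by rewrite mulr0.
    by rewrite mulrCA eq_sym /sub; have [->|] := eqVneq a d; rewrite ?mul0r.
  rewrite jwZ jw_ins_lin; congr (_ * (_ + _)).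
  by rewrite -jwZ; congr jw; apply/funext => -[|b u'] /=; rewrite ?mulr0 // mulrCA.
have term a d : s a * jw (ins d (F a d)) (a :: u) =
    (d == a)%:R * (Y u v - r * H a a u - rho (size u) * J a)
    + rho (size u) * r * (q (bar a) * s (bar d) * G a d).
  rewrite (wenzl n_gt0 _ _ _ (isE_F a d)).
  rewrite jwF /F eq_sym.
  have -> : s a * ((d == a)%:R * (q d * (- (r * (q (bar a) * s (bar d))) * H a d u
      + (d == a)%:R * Y u v)) -
      rho (size u) * (q a * s d * (q d * (- (r * (q (bar a) * s (bar d))) * G a d
      + (d == a)%:R * J a)))) =
    (d == a)%:R * (s a * q d * ((d == a)%:R * Y u v
       - r * (s (bar d) * q (bar a)) * H a d u))
    - (s a * q a) * (s d * q d) * (rho (size u) * (- (r * (q (bar a) * s (bar d))) * G a d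
      + (d == a)%:R * J a)) by ring.
  rewrite !cap_cup; have [->|_] := eqVneq d a; last by rewrite /=; ring.
  by rewrite !cap_cup (_ : true%:R = 1) //; ring.
rewrite {1}/cap2 raise_capE.
under eq_bigr => a _.
  rewrite raise_cons mulr_sumr; under eq_bigr do rewrite term.
  rewrite big_split /= sum_pick -mulr_sumr; over.
rewrite big_split /= -mulr_sumr; congr (_ + _).
(* The two mixed sums reassemble [Y], which is fixed by the projection on either side. *)
rewrite !sumrB sumr_const card_ord -(sum_bar (fun a => r * H a a u)).
rewrite (rho_split (f := Y u v)); last by rewrite jw_id //; exact: EY.2.
rewrite (rho_split (f := Y u v)); last by rewrite (jw_id n_gt0 (EY.1 v)).
by rewrite -mulr_natl; ring.
Qed.
End CapRaise.
End TwoSided.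

(** * The weighted inner product and adjoints *)

Section InnerProduct.
Variables (K : numClosedFieldType) (n : nat).
Hypothesis n_gt0 : (0 < n)%N.
Local Notation I := 'I_n.+1.
Local Notation tensor := (seq I -> K).
Local Notation bitensor := (seq I -> seq I -> K).
Local Notation m := (@mass K n).
Local Notation s := (@cap_coef K n).
Local Notation q := (@cup_coef K n).
Local Notation N := (n.+1%:R : K).
Local Notation rho := (rho K n).
Implicit Types (a b d : I) (u v w : seq I) (X Y W : bitensor) (z f g : tensor).
Implicit Types (k l j : nat).

Fixpoint wsum k f : K :=
  if k is k'.+1 then \sum_a wsum k' (sub a f) else f [::].

Definition wmass u : K := \prod_(a <- u) m a.
Definition wdot k f g := wsum k (fun w => wmass w * f w * (g w)^*).
Definition dot2 k l X Y := wsum k (fun u => wmass u * wdot l (X u) (Y u)).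

Lemma wsum_ext k f g : (forall w, size w = k -> f w = g w) -> wsum k f = wsum k g.
Proof.
elim: k f g => [|k IH] f g fg /=; first exact: fg.
by apply: eq_bigr => a _; apply: IH => w wk; apply: fg; rewrite /= wk.
Qed.

Lemma wsum_eq0 k f : (forall w, size w = k -> f w = 0) -> wsum k f = 0.
Proof.
elim: k f => [|k IH] f f0 /=; first exact: f0.
by rewrite big1 // => a _; apply: IH => w wk; apply: f0; rewrite /= wk.
Qed.

Lemma wsum_sum k (T : Type) (r : seq T) (F : T -> tensor) :
  wsum k (fun w => \sum_(i <- r) F i w) = \sum_(i <- r) wsum k (F i).
Proof.
elim: k F => [//|k IH] F /=; rewrite exchange_big; apply: eq_bigr => a _.
exact: IH.
Qed.

Lemma wsumZ k c f : wsum k (fun w => c * f w) = c * wsum k f.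
Proof.
elim: k f => [//|k IH] f /=; rewrite mulr_sumr; apply: eq_bigr => a _.
exact: IH.
Qed.

Lemma wsum_exchange k l (F : seq I -> seq I -> K) :
  wsum k (fun u => wsum l (F u)) = wsum l (fun v => wsum k (F^~ v)).
Proof.
elim: k F => [//|k IH] F /=; rewrite wsum_sum; apply: eq_bigr => a _.
exact: (IH (fun u => F (a :: u))).
Qed.

Lemma wsum_conj k f : (wsum k f)^* = wsum k (fun w => (f w)^*).
Proof.
elim: k f => [//|k IH] f /=; rewrite rmorph_sum; apply: eq_bigr => a _.
exact: IH.
Qed.

Lemma wsum_cat k l f :
  wsum (k + l) f = wsum k (fun u => wsum l (fun v => f (u ++ v))).
Proof.
elim: k f => [//|k IH] f /=; apply: eq_bigr => a _.
exact: IH.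
Qed.

Lemma wsumSr k f : wsum k.+1 f = wsum k (fun w => \sum_a f (rcons w a)).
Proof.
rewrite -addn1 wsum_cat; apply: wsum_ext => u _ /=.
by apply: eq_bigr => a _; rewrite /sub cats1.
Qed.

Lemma wsum_rev k f : wsum k (fun w => f (rev w)) = wsum k f.
Proof.
elim: k f => [//|k IH] f; rewrite [RHS]wsumSr wsum_sum /=.
apply: eq_bigr => a _; rewrite -[RHS]IH; apply: wsum_ext => w _.
by rewrite /sub rev_cons.
Qed.

Lemma wmass_cat u v : wmass (u ++ v) = wmass u * wmass v.
Proof. exact: big_cat. Qed.

Lemma wmass_cons a u : wmass (a :: u) = m a * wmass u.
Proof. exact: big_cons. Qed.

Lemma wmass_rev u : wmass (rev u) = wmass u.
Proof. by rewrite /wmass (perm_big u) //= perm_rev. Qed.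

Lemma conj_wmass u : (wmass u)^* = wmass u.
Proof. by rewrite rmorph_prod; apply: eq_bigr => a _; rewrite /= /mass conjC_nat. Qed.

Lemma wdotS k f g : wdot k.+1 f g = \sum_a m a * wdot k (sub a f) (sub a g).
Proof.
apply: eq_bigr => a _; rewrite -wsumZ; apply: wsum_ext => w _.
by rewrite /sub wmass_cons !mulrA.
Qed.

Lemma wdot_ext k f f' g g' : (forall w, size w = k -> f w = f' w) ->
  (forall w, size w = k -> g w = g' w) -> wdot k f g = wdot k f' g'.
Proof. by move=> ff gg; apply: wsum_ext => w wk; rewrite ff ?gg. Qed.

Lemma wdot_suml k (T : Type) (r : seq T) (c : T -> K) (F : T -> tensor) g :
  wdot k (fun w => \sum_(i <- r) c i * F i w) g = \sum_(i <- r) c i * wdot k (F i) g.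
Proof.
under [RHS]eq_bigr do rewrite -wsumZ.
rewrite -wsum_sum; apply: wsum_ext => w _.
rewrite mulr_sumr mulr_suml; apply: eq_bigr => i _.
by rewrite [in LHS]mulrCA !mulrA.
Qed.

Lemma wdot_sumr k (T : Type) (r : seq T) (c : T -> K) f (G : T -> tensor) :
  wdot k f (fun w => \sum_(i <- r) c i * G i w) =
  \sum_(i <- r) (c i)^* * wdot k f (G i).
Proof.
under [RHS]eq_bigr do rewrite -wsumZ.
rewrite -wsum_sum; apply: wsum_ext => w _.
rewrite rmorph_sum mulr_sumr; apply: eq_bigr => i _.
by rewrite rmorphM /= mulrCA.
Qed.

Lemma wdotC k f g : wdot k g f = (wdot k f g)^*.
Proof.
rewrite wsum_conj; apply: wsum_ext => w _.
by rewrite !rmorphM /= conj_wmass conjCK mulrAC.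
Qed.

Lemma wdot_lin k c f f' g :
  wdot k (fun w => c * f w + f' w) g = c * wdot k f g + wdot k f' g.
Proof.
have := wdot_suml k [:: true; false] (fun b : bool => if b then c else 1)
  (fun b : bool => if b then f else f') g.
rewrite !big_cons !big_nil addr0 mul1r => <-; apply: wsum_ext => w _.
by rewrite !big_cons !big_nil addr0 mul1r.
Qed.

Lemma wdot_cup k f g : wdot k.+2 (cup f) g = wdot k f (cap g).
Proof.
rewrite wdotS wdot_sumr; apply: eq_bigr => a _.
rewrite wdotS mulr_sumr.
under eq_bigr => b _.
  rewrite (_ : m a * _ =
    (b == bar a)%:R * (m a * m b * q a * wdot k f (sub b (sub a g)))).
    over.
  rewrite (_ : wdot k _ _ = (b == bar a)%:R * (q a * wdot k f (sub b (sub a g)))).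
    by ring.
  by rewrite -!wsumZ; apply: wsum_ext => w _; rewrite /sub /=; ring.
by rewrite sum_pick mass_cup conj_cap.
Qed.

Lemma wdot0r k f : wdot k f (fun=> 0) = 0.
Proof.
rewrite -[RHS](mul0r (wsum k f)) -wsumZ; apply: wsum_ext => w _.
by rewrite rmorph0 mulr0 mul0r.
Qed.

(** The correction term is a projected cup, hence orthogonal to g, whose cap vanishes. Together with
    [isE_jw] this makes [jw] the orthogonal projection onto E. *)
Lemma wdot_jw k f g : isE g -> wdot k (jw f) g = wdot k f g.
Proof.
elim: k f g => [//|k IH] f g Eg; rewrite !wdotS.
pose C := cup (cap (jw1 f)).
have jwS a : wdot k (sub a (jw f)) (sub a g) =
    - rho k * wdot k (sub a C) (sub a g) + wdot k (sub a f) (sub a g).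
  rewrite -(IH (sub a C)) -1?(IH (sub a f)); try exact: isE_sub.
  rewrite -wdot_lin; apply: wdot_ext => // w wk.
  by rewrite [LHS]/sub (jw_rec f) /= wk addrC mulNr.
under eq_bigr do rewrite jwS mulrDr mulrCA.
rewrite big_split /= -mulr_sumr -(wdotS k C) -[RHS]add0r; congr (_ + _).
(* A single letter leaves nothing to contract; rho_0 = 0 removes the term. *)
case: k {IH jwS} => [|k]; first by rewrite oppr0 mul0r.
rewrite wdot_cup (_ : cap g = fun=> 0) ?wdot0r ?mulr0 //.
by apply/funext => w; exact: (Eg [::]).
Qed.

Lemma dot2_swap k l X Y :
  dot2 k l X Y = wsum l (fun v => wmass v * wdot k (X^~ v) (Y^~ v)).
Proof.
transitivity (wsum k (fun u => wsum l (fun v =>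
    wmass u * (wmass v * X u v * (Y u v)^*)))).
  by apply: wsum_ext => u _; rewrite -wsumZ.
rewrite wsum_exchange; apply: wsum_ext => v _; rewrite -wsumZ.
by apply: wsum_ext => u _; rewrite !mulrA (mulrC (wmass u)).
Qed.

Lemma dot2_ext k l X X' Y Y' :
  (forall u v, size u = k -> size v = l -> X u v = X' u v) ->
  (forall u v, size u = k -> size v = l -> Y u v = Y' u v) ->
  dot2 k l X Y = dot2 k l X' Y'.
Proof.
move=> XX YY; apply: wsum_ext => u uk; congr (_ * _).
by apply: wdot_ext => v vl; rewrite ?XX ?YY.
Qed.

Lemma dot2C k l X Y : dot2 k l Y X = (dot2 k l X Y)^*.
Proof.
rewrite wsum_conj; apply: wsum_ext => u _.
by rewrite rmorphM /= conj_wmass wdotC.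
Qed.

Lemma dot2Zr k l c X Y : dot2 k l X (fun u v => c * Y u v) = c^* * dot2 k l X Y.
Proof.
rewrite -wsumZ; apply: wsum_ext => u _; rewrite [RHS]mulrCA; congr (_ * _).
by rewrite -wsumZ; apply: wsum_ext => v _; rewrite rmorphM /= mulrCA.
Qed.

Lemma dot2_0r k l X : dot2 k l X (fun _ _ => 0) = 0.
Proof.
rewrite -[RHS](mul0r (wsum k (fun=> 0))) -wsumZ; apply: wsum_ext => u _.
by rewrite wdot0r mulr0 mul0r.
Qed.

Lemma dot2_jw2 k l X Y : isE2 Y -> dot2 k l (jw2 X) Y = dot2 k l X Y.
Proof.
move=> [El Er]; transitivity (dot2 k l (fun u v => jw (X u) v) Y).
  by rewrite !dot2_swap; apply: wsum_ext => v _; rewrite -[in RHS](wdot_jw _ _ (El v)).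
by apply: wsum_ext => u _; rewrite -[in RHS](wdot_jw _ _ (Er u)).
Qed.

Lemma dot2_cup2 k l X Y : dot2 k.+1 l.+1 (cup2 X) Y = dot2 k l X (cap2 Y).
Proof.
rewrite /dot2 /= -wsum_sum; apply: wsum_ext => u _.
rewrite wdot_sumr mulr_sumr; apply: eq_bigr => a _.
rewrite /sub wmass_cons -mulrA mulrCA; congr (_ * _).
rewrite wdotS mulr_sumr.
under eq_bigr => b _.
  rewrite (_ : m a * _ =
    (b == bar a)%:R * (m a * m b * q a * wdot l (X u) (sub b (Y (a :: u))))).
    over.
  rewrite (_ : wdot l _ _ = (b == bar a)%:R * (q a * wdot l (X u) (sub b (Y (a :: u))))).
    by ring.
  by rewrite -!wsumZ; apply: wsum_ext => w _; rewrite /sub /=; ring.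
by rewrite sum_pick mass_cup conj_cap.
Qed.

Lemma dot2_raise k l X Y : isE2 Y ->
  dot2 k.+1 l.+1 (raise X) Y = dot2 k l X (cap2 Y).
Proof. by move=> EY; rewrite dot2_jw2 // dot2_cup2. Qed.

(** * The ladder of raising operators *)

Definition tower X j := iter j (@raise K n) X.

(** The scalar by which [cap2] undoes the last of j raisings, with k and l the lengths after the
    contraction; the recursion is [cap2_raise] read on a tower. The value 0 at j = 0 reflects that a
    top vector is killed. *)
Fixpoint lam j k l : K :=
  if j is j'.+1 then
    N - rho k - rho l + rho k * rho l * lam j' k.-1 l.-1
  else 0.

(** The factor by which j raisings, ending at lengths k and l, multiply the squared norm of a top
    vector. *)
Fixpoint nrm j k l : K :=
  if j is j'.+1 then lam j k.-1 l.-1 * nrm j' k.-1 l.-1 else 1.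

Definition is_top X := isE2 X /\ (forall u v, cap2 X u v = 0).

Lemma isE2_tower X j : isE2 X -> isE2 (tower X j).
Proof. by case: j => // j _; exact: isE2_jw2. Qed.

Lemma cap2_tower X j u v : is_top X ->
  cap2 (tower X j) u v = lam j (size u) (size v) * tower X j.-1 u v.
Proof.
move=> [EX cX]; elim: j u v => [|j IH] u v; first by rewrite cX mul0r.
rewrite [tower X j.+1]/(raise (tower X j)) cap2_raise //; last exact: isE2_tower.
rewrite [lam _ _ _]/= [RHS]mulrDl; congr (_ + _); rewrite -!mulrA.
(* On an empty word [raise] vanishes, and so does the coefficient, since rho_0 = 0. *)
case: u => [|a u]; first by rewrite raise_nil // !mul0r.
case: v => [|b v]; first by rewrite raise_nil ?orbT // !mulr0 mul0r mulr0.
congr (_ * (_ * _)); rewrite [in RHS]/=.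
have XY u' v' : size u' = size u -> size v' = size v ->
    cap2 (tower X j) u' v' = lam j (size u) (size v) * tower X j.-1 u' v'.
  by move=> <- <-.
rewrite (raise_ext XY) // raiseZ; case: j {IH XY} => [|j] //.
by rewrite !mul0r.
Qed.

Lemma lam_bounds j k l : 0 <= lam j k l /\ 0 < lam j.+1 k l.
Proof.
have lamS i k' l' : 0 <= lam i k'.-1 l'.-1 -> 0 < lam i.+1 k' l'.
  move=> li; have /andP[r0 r1] := rho_bounds K n_gt0 k'.
  have /andP[r0' r1'] := rho_bounds K n_gt0 l'.
  rewrite /= ltr_wpDr ?mulr_ge0 // -addrA -opprD subr_gt0.
  rewrite (lt_le_trans (ltrD r1 r1')) //.
  by rewrite -[1 + 1]/(2%:R) ler_nat.
suff lam_ge0 : forall i k l, 0 <= lam i k l by split; [|exact: lamS].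
by elim=> [//|i IH] k' l'; exact/ltW/lamS.
Qed.

Lemma conj_lam j k l : (lam j k l)^* = lam j k l.
Proof. by apply: conj_Creal; apply: ger0_real; case: (lam_bounds j k l). Qed.

Lemma nrm_gt0 j k l : 0 < nrm j k l.
Proof.
elim: j k l => [|j IH] k l; first exact: ltr01.
by rewrite [nrm _ _ _]/= mulr_gt0 ?IH //; case: (lam_bounds j k.-1 l.-1).
Qed.

(** Each raising crosses the inner product as a contraction, which peels one factor [lam] off the
    other tower. *)
Lemma dot2_tower X Y j k l : is_top X -> is_top Y -> (j <= k)%N -> (j <= l)%N ->
  dot2 k l (tower X j) (tower Y j) = nrm j k l * dot2 (k - j) (l - j) X Y.
Proof.
move=> TX TY; elim: j k l => [|j IH] k l; first by rewrite !subn0 mul1r.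
case: k l => [//|k] [//|l] jk jl.
rewrite dot2_raise; last by apply: isE2_tower; case: TY.
have XY u v : size u = k -> size v = l ->
    cap2 (tower Y j.+1) u v = lam j.+1 k l * tower Y j u v.
  by move=> <- <-; rewrite cap2_tower.
rewrite (@dot2_ext _ _ _ (tower X j) _ _ _ XY) // dot2Zr conj_lam IH //.
by rewrite [nrm _ _ _]/= mulrA !subSS.
Qed.

(** After i contractions the second tower has become a top vector while a raising is still left on
    the first; moved across, it kills the top vector. *)
Lemma dot2_tower_lt X Y i j k l : is_top X -> is_top Y ->
  (i < j)%N -> (j <= k)%N -> (j <= l)%N ->
  dot2 k l (tower X j) (tower Y i) = 0.
Proof.
move=> TX TY; elim: i j k l => [|i IH] [//|j] [//|k] [//|l] ij jk jl;
  (rewrite dot2_raise; last by apply: isE2_tower; case: TY).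
  rewrite (@dot2_ext _ _ _ (tower X j) _ (fun _ _ => 0)) ?dot2_0r // => u v _ _.
  by case: TY => _ ->.
have XY u v : size u = k -> size v = l ->
    cap2 (tower Y i.+1) u v = lam i.+1 k l * tower Y i u v.
  by move=> <- <-; rewrite cap2_tower.
by rewrite (@dot2_ext _ _ _ (tower X j) _ _ _ XY) // dot2Zr IH ?mulr0.
Qed.

Lemma dot2_tower_neq X Y i j k l : is_top X -> is_top Y -> i != j ->
  (i <= k)%N -> (i <= l)%N -> (j <= k)%N -> (j <= l)%N ->
  dot2 k l (tower X i) (tower Y j) = 0.
Proof.
move=> TX TY ij ik il jk jl; case: (ltngtP i j) ij => // [ij|ji] _.
  by rewrite dot2C dot2_tower_lt // rmorph0.
exact: dot2_tower_lt.
Qed.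

End InnerProduct.

(** * The towers exhaust E_k (x) E_l *)

Section Decomposition.
Variables (K : numClosedFieldType) (n : nat).
Hypothesis n_gt0 : (0 < n)%N.
Local Notation I := 'I_n.+1.
Local Notation tensor := (seq I -> K).
Local Notation bitensor := (seq I -> seq I -> K).
Local Notation s := (@cap_coef K n).
Local Notation q := (@cup_coef K n).
Local Notation lam := (lam K n).
Local Notation rho := (rho K n).
Implicit Types (a b d : I) (u v w : seq I) (X Y W : bitensor) (z f g : tensor).
Implicit Types (k l j : nat).

Definition unflat z : bitensor := fun u v => z (rev u ++ v).
Definition flat k l X : tensor := fun w =>
  if size w == (k + l)%N then X (rev (take k w)) (drop k w) else 0.

Lemma isE_bar z u v : isE z -> \sum_a s a * z (u ++ [:: bar a, a & v]) = 0.
Proof.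
move=> Ez; rewrite -(sum_bar (fun a => s a * _)).
under eq_bigr do rewrite barK cap_bar -mulrA.
by rewrite -mulr_sumr Ez mulr0.
Qed.

Lemma is_top_unflat z : isE z -> is_top (unflat z).
Proof.
move=> Ez; rewrite /unflat; split; first split=> [v u1 u2|u v1 v2].
- rewrite -[RHS](isE_bar (rev u2) (rev u1 ++ v) Ez); apply: eq_bigr => a _.
  by rewrite rev_cat !rev_cons !cat_rcons -catA.
- by rewrite -[RHS](Ez (rev u ++ v1) v2); apply: eq_bigr => a _; rewrite catA.
- move=> u v; rewrite -[RHS](Ez (rev u) v); apply: eq_bigr => a _.
  by rewrite rev_cons cat_rcons.
Qed.

Lemma unflat_flat k l X u v : size u = k -> size v = l ->
  unflat (flat k l X) u v = X u v.
Proof.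
move=> uk vl; rewrite /unflat /flat size_cat size_rev uk vl eqxx.
by rewrite take_size_cat ?size_rev // drop_size_cat ?size_rev // revK.
Qed.

(** The kernel of c is E_{k+l}: a contraction falls in the right word, or in the left one, where the
    letters run backwards and [isE_bar] applies, or straddles the junction, where it is [cap2]. Off
    length k + l, [flat] is 0 and nothing has to be shown. *)
Lemma isE_flat k l X : isE2 X ->
  (forall u v, (size u).+1 = k -> (size v).+1 = l -> cap2 X u v = 0) ->
  isE (flat k l X).
Proof.
move=> [El Er] cX u v; rewrite /flat.
have sE a : size (u ++ [:: a, bar a & v]) = (size u + (size v).+2)%N.
  by rewrite size_cat.
case: (eqVneq (size u + (size v).+2)%N (k + l)%N) => uv; last first.
  by rewrite big1 // => a _; rewrite sE (negbTE uv) mulr0.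
under eq_bigr do rewrite sE uv eqxx.
case: (leqP k (size u)) => ku.
  rewrite -[RHS](Er (rev (take k u)) (drop k u) v); apply: eq_bigr => a _.
  move: ku; rewrite leq_eqVlt => /predU1P[->|ku].
    by rewrite take_size_cat // drop_size_cat // take_size drop_size.
  by rewrite take_cat drop_cat ku.
(* [p] counts the letters of the left factor after [u]: p = 1 is the junction, p >= 2 a contraction
   within the left factor. *)
pose p := (k - size u)%N.
have kE : k = (size u + p)%N by rewrite subnKC // ltnW.
have p_gt0 : (0 < p)%N by rewrite subn_gt0.
have tE w : take k (u ++ w) = u ++ take p w by rewrite kE takeD take_size_cat // drop_size_cat.
have dE w : drop k (u ++ w) = drop p w by rewrite kE addnC -drop_drop drop_size_cat.
under eq_bigr do rewrite tE dE rev_cat.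
case: p => [//|[|p]] in kE p_gt0 tE dE *.
  rewrite -[RHS](cX (rev u) v); last by lia.
    by apply: eq_bigr => a _; rewrite /= ?drop0.
  by rewrite size_rev kE addn1.
rewrite -[RHS](isE_bar (rev (take p v)) (rev u) (El (drop p v))).
by apply: eq_bigr => a _; rewrite /= !rev_cons !cat_rcons.
Qed.

Lemma isE2_lin c X Y : isE2 X -> isE2 Y -> isE2 (fun u v => c * X u v + Y u v).
Proof. by move=> [Xl Xr] [Yl Yr]; split=> [v|u]; apply: isE_lin. Qed.

Lemma isE2_sum (T : Type) (r : seq T) (c : T -> K) (F : T -> bitensor) :
  (forall i, isE2 (F i)) -> isE2 (fun u v => \sum_(i <- r) c i * F i u v).
Proof.
move=> EF; split=> [v|u].
  by apply: (@isE_sum _ _ _ _ c (fun i u => F i u v)) => i; case: (EF i).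
by apply: (@isE_sum _ _ _ _ c (fun i v => F i u v)) => i; case: (EF i).
Qed.

Lemma tower_lin c X Y j u v :
  tower (fun u v => c * X u v + Y u v) j u v = c * tower X j u v + tower Y j u v.
Proof.
elim: j u v => [//|j IH] u v; rewrite /tower /= -!/(tower _ j) -raise_lin.
by congr (raise _ u v); apply/funext => u'; apply/funext => v'; rewrite IH.
Qed.

Lemma towerZ c X j u v : tower (fun u v => c * X u v) j u v = c * tower X j u v.
Proof.
elim: j u v => [//|j IH] u v; rewrite /tower /= -!/(tower _ j) -raiseZ.
by congr (raise _ u v); apply/funext => u'; apply/funext => v'; rewrite IH.
Qed.

Lemma cap2_sum (T : Type) (r : seq T) (c : T -> K) (F : T -> bitensor) u v :
  cap2 (fun u v => \sum_(i <- r) c i * F i u v) u v =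
  \sum_(i <- r) c i * cap2 (F i) u v.
Proof.
under [RHS]eq_bigr do rewrite mulr_sumr.
rewrite exchange_big; apply: eq_bigr => a _; rewrite mulr_sumr.
by apply: eq_bigr => i _; rewrite mulrCA.
Qed.

Lemma decomposition_top k l X : isE2 X ->
  (forall u v, (size u).+1 = k -> (size v).+1 = l -> cap2 X u v = 0) ->
  minn k l = 0%N ->
  exists z : nat -> tensor, (forall j, isE (z j)) /\
  forall u v, size u = k -> size v = l ->
    X u v = \sum_(j < (minn k l).+1) tower (unflat (z j)) j u v.
Proof.
move=> EX cX kl0; exists (fun=> flat k l X); split=> [_|u v uk vl].
  exact: isE_flat.
by rewrite kl0 big_ord_recl big_ord0 addr0 [RHS]unflat_flat.
Qed.

Lemma decomposition k l X : isE2 X ->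
  exists z : nat -> tensor, (forall j, isE (z j)) /\
  forall u v, size u = k -> size v = l ->
    X u v = \sum_(j < (minn k l).+1) tower (unflat (z j)) j u v.
Proof.
elim: k l X => [|k IH] [|l] X EX; try by apply: decomposition_top => //; lia.
have [z [Ez zE]] := IH l _ (isE2_cap2 EX).
pose r := index_enum 'I_(minn k l).+1.
(* Contracting [T j] returns the tower below it times [lam j.+1 k l]; dividing by this scalar makes
   [cap2 X'] vanish. *)
pose c (j : 'I_(minn k l).+1) := (lam j.+1 k l)^-1.
pose T (j : 'I_(minn k l).+1) := tower (unflat (z j)) j.+1.
pose X' u v := -1 * (\sum_(j <- r) c j * T j u v) + X u v.
have EX' : isE2 X'.
  apply: isE2_lin => //; apply: isE2_sum => j; apply: isE2_tower => //.
  by case: (is_top_unflat (Ez j)).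
have cX' u v : (size u).+1 = k.+1 -> (size v).+1 = l.+1 -> cap2 X' u v = 0.
  move=> [uk] [vl].
  have -> : cap2 X' u v = - cap2 (fun u v => \sum_(j <- r) c j * T j u v) u v + cap2 X u v.
    rewrite -mulN1r mulr_sumr -big_split; apply: eq_bigr => a _.
    by rewrite mulrDr mulrCA.
  rewrite cap2_sum zE // addrC -sumrB big1 // => j _.
  rewrite cap2_tower //; last exact: is_top_unflat.
  rewrite uk vl mulrA mulVf ?mul1r ?subrr // gt_eqF //.
  by case: (lam_bounds K n_gt0 j k l).
(* The components of [cap2 X] move up one rung, which frees index 0 for the remainder in
   E_{k+l+2}. *)
exists (fun j => if j is j'.+1 then fun w => (lam j k l)^-1 * z j' w
                 else flat k.+1 l.+1 X').
split=> [[|j]|u v uk vl]; [exact: isE_flat|exact: isEZ|].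
rewrite minnSS big_ord_recl [X in _ = X + _]unflat_flat // /X' mulN1r.
rewrite addrAC -[LHS]add0r; congr (_ + _).
apply/esym/eqP; rewrite addrC subr_eq0; apply/eqP; apply: eq_bigr => j _.
exact: towerZ.
Qed.

End Decomposition.

(** * Equivariance of projections and raisings *)

Section Equivariance.
Variables (K : numClosedFieldType) (n : nat).
Hypothesis n_gt0 : (0 < n)%N.
Local Notation I := 'I_n.+1.
Local Notation tensor := (seq I -> K).
Local Notation bitensor := (seq I -> seq I -> K).
Local Notation s := (@cap_coef K n).
Local Notation q := (@cup_coef K n).
Local Notation rho := (rho K n).
Implicit Types (a b d : I) (u v w : seq I) (X Y W : bitensor) (z f g : tensor).
Implicit Types (k l j : nat).

Variable U : I -> I -> K.

Fixpoint act f w : K :=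
  if w is a :: w' then \sum_b U a b * act (sub b f) w' else f [::].
Definition act2 X : bitensor := fun u v => act (fun u' => act (X u') v) u.

Lemma act_ext f g w : (forall v, size v = size w -> f v = g v) -> act f w = act g w.
Proof.
elim: w f g => [|a w IH] f g fg /=; first exact: fg.
by apply: eq_bigr => b _; congr (_ * _); apply: IH => v vw; apply: fg; rewrite /= vw.
Qed.

Lemma act_sum (T : Type) (r : seq T) (c : T -> K) (F : T -> tensor) w :
  act (fun v => \sum_(i <- r) c i * F i v) w = \sum_(i <- r) c i * act (F i) w.
Proof.
elim: w F => [//|a w IH] F /=.
under [RHS]eq_bigr do rewrite mulr_sumr.
rewrite exchange_big; apply: eq_bigr => b _.
rewrite (IH (fun i => sub b (F i))) mulr_sumr.
by apply: eq_bigr => i _; rewrite mulrCA.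
Qed.

Lemma act_lin c f g w : act (fun v => c * f v + g v) w = c * act f w + act g w.
Proof.
have := act_sum [:: true; false] (fun b : bool => if b then c else 1)
  (fun b : bool => if b then f else g) w.
rewrite !big_cons !big_nil addr0 mul1r => <-; apply: act_ext => v _.
by rewrite !big_cons !big_nil addr0 mul1r.
Qed.

Lemma actZ c f w : act (fun v => c * f v) w = c * act f w.
Proof.
have := act_sum [:: tt] (fun=> c) (fun=> f) w.
rewrite !big_cons !big_nil addr0 => <-; apply: act_ext => v _.
by rewrite !big_cons !big_nil addr0.
Qed.

Lemma act0 w : act (fun=> 0) w = 0.
Proof.
rewrite -[RHS](mul0r (act (fun=> 0) w)) -actZ.
by apply: act_ext => v _; rewrite mulr0.
Qed.

Lemma act_cat f u v : act f (u ++ v) = act (fun u' => act (fun v' => f (u' ++ v')) v) u.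
Proof. by elim: u f => [//|a u IH] f /=; apply: eq_bigr => b _; rewrite IH. Qed.

Lemma act_rev f u : act (fun w => f (rev w)) u = act f (rev u).
Proof.
elim: u f => [//|a u IH] f; rewrite rev_cons -cats1 act_cat /= act_sum.
apply: eq_bigr => b _; rewrite -(IH (fun w => f (w ++ [:: b]))); congr (_ * _).
by apply: act_ext => w _; rewrite /sub rev_cons cats1.
Qed.

Lemma act2_unflat f : act2 (unflat f) = unflat (act f).
Proof.
apply/funext => u; apply/funext => v; rewrite /unflat act_cat.
by rewrite -(act_rev (fun u' => act (fun v' => f (u' ++ v')) v)).
Qed.

Lemma act_jw_exchange X u v :
  act (fun v' => jw (X^~ v') u) v = jw (fun u' => act (X u') v) u.
Proof.
elim: v X => [//|a v IH] X /=; rewrite jw_sum; apply: eq_bigr => b _.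
by rewrite jwZ (IH (fun u' => sub b (X u'))).
Qed.

(** The matrix U preserves the bilinear form [cap] and, by the next hypothesis, the vector delta;
    whatever is built from cups and caps then commutes with the action. *)
Hypothesis cap_inv : forall b d,
  \sum_a s a * U a b * U (bar a) d = s b * (d == bar b)%:R.
Hypothesis cup_inv : forall a d,
  \sum_b U a b * q b * U d (bar b) = q a * (d == bar a)%:R.

Lemma cap_act f w : cap (act f) w = act (cap f) w.
Proof.
rewrite /cap act_sum /=.
under eq_bigr => a _ do (rewrite mulr_sumr; under eq_bigr do rewrite 2!mulr_sumr).
rewrite exchange_big; apply: eq_bigr => b _; rewrite exchange_big.
rewrite -[in RHS](sum_pick (bar b) (fun d => act (sub d (sub b f)) w)) mulr_sumr.
apply: eq_bigr => d _; rewrite mulrA -cap_inv mulr_suml.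
by apply: eq_bigr => a _; rewrite !mulrA.
Qed.

Lemma cup_act f w : cup (act f) w = act (cup f) w.
Proof.
case: w => [//|a [|c w]] /=; first by rewrite mulr0 big1 // => b _; rewrite /sub /= !mulr0.
rewrite mulrA -cup_inv mulr_suml; apply: eq_bigr => b _.
rewrite [LHS](_ : _ = U a b * (q b * (U c (bar b) * act f w))); last by ring.
congr (_ * _); rewrite -[LHS](sum_pick (bar b) (fun d => q b * (U c d * act f w))).
apply: eq_bigr => d _; rewrite [RHS](_ : _ = U c d * (q b * ((d == bar b)%:R * act f w))); last first.
  by rewrite -!actZ.
by ring.
Qed.

Lemma jw_act f w : jw (act f) w = act (jw f) w.
Proof.
have [k] := ubnP (size w); elim: k f w => [//|k IH] f w.
case: w => [//|a w] wk.
have jw1_act g v : size v = size (a :: w) -> jw1 (act g) v = act (jw1 g) v.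
  case: v => [//|b v] /= [vw]; rewrite jw_sum; apply: eq_bigr => c _.
  by rewrite jwZ IH // vw.
rewrite jw_rec jw1_act //.
rewrite (@jw1_ext _ _ (cup (cap (jw1 (act f)))) (act (cup (cap (jw1 f))))); last first.
  move=> v vw; rewrite -cup_act; apply: cup_ext => v' v'v.
  rewrite -cap_act; apply: eq_bigr => b _; congr (_ * _).
  by rewrite jw1_act // -vw -v'v.
rewrite jw1_act // addrC -mulNr -act_lin; apply: act_ext => v vw.
by rewrite [RHS]jw_rec vw addrC mulNr.
Qed.

Lemma isE_act f : isE f -> isE (act f).
Proof.
move=> Ef; rewrite (_ : act f = jw (act f)); first exact: isE_jw.
by apply/funext => w; rewrite jw_act jw_id.
Qed.

Lemma jw2_act2 X u v : jw2 (act2 X) u v = act2 (jw2 X) u v.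
Proof.
rewrite /act2 /jw2.
transitivity (jw (act (fun u' => jw (act (X u')) v)) u).
  by congr jw; apply/funext => u'; rewrite -(act_jw_exchange (fun v' u'' => act (X u'') v')).
rewrite jw_act; apply: act_ext => u' _.
rewrite (act_jw_exchange (fun u'' v' => jw (X u'') v')); congr jw.
by apply/funext => u''; rewrite jw_act.
Qed.

Lemma cup2_act2 X u v : cup2 (act2 X) u v = act2 (cup2 X) u v.
Proof.
case: u => [|a u] /=; first by rewrite /act2 /= act0.
rewrite /act2 /=; case: v => [|c v] /=.
  rewrite mulr0 big1 // => b _; rewrite (_ : sub _ _ = fun=> 0) ?act0 ?mulr0 //.
  by apply/funext => u'; rewrite /sub /= mulr0.
rewrite mulrA -cup_inv mulr_suml; apply: eq_bigr => b _.
rewrite [LHS](_ : _ = U a b * (q b * U c (bar b) * act (fun u' => act (X u') v) u)); last by ring.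
congr (_ * _); rewrite -actZ; apply: act_ext => u' _; rewrite /sub /= -mulrA.
rewrite -[LHS](sum_pick (bar b) (fun d => q b * (U c d * act (X u') v))).
apply: eq_bigr => d _.
rewrite [RHS](_ : _ = U c d * (q b * ((d == bar b)%:R * act (X u') v))).
  by ring.
by rewrite -!actZ.
Qed.

Lemma tower_act2 X j u v : tower (act2 X) j u v = act2 (tower X j) u v.
Proof.
elim: j u v => [//|j IH] u v; rewrite /tower /= -!/(tower _ j) /raise.
rewrite -jw2_act2; congr (jw2 _ u v); apply/funext => u'; apply/funext => v'.
rewrite -cup2_act2; congr (cup2 _ u' v'); apply/funext => u''; apply/funext => v''.
exact: IH.
Qed.

End Equivariance.

(** * The weight basis *)

Section Weights.
Variable n : nat.
Local Notation I := 'I_n.+1.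
Local Notation slot := {ffun 'I_n -> 'I_2}.
Implicit Types (t : slot) (a b : I).

Definition ones t : {set 'I_n} := [set k | t k != ord0].
Definition wt t : I := inord #|ones t|.

Lemma val_wt t : wt t = #|ones t| :> nat.
Proof. by rewrite inordK // ltnS -[leqRHS]card_ord max_card. Qed.

Lemma card_onesC t : #|~: ones t| = (n - #|ones t|)%N.
Proof. by rewrite cardsCs setCK card_ord. Qed.

Lemma ord2_neq0 (b : 'I_2) : b != ord0 -> b = ord_max.
Proof. by case: b => -[|[|]] //= lt_b _; apply: val_inj. Qed.

Definition indic (A : {set 'I_n}) : slot := [ffun k => if k \in A then ord_max else ord0].

Lemma onesK : cancel ones indic.
Proof.
move=> t; apply/ffunP => k; rewrite ffunE inE.
by case: eqVneq => [->|/ord2_neq0->].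
Qed.

Lemma indicK : cancel indic ones.
Proof. by move=> A; apply/setP => k; rewrite inE ffunE; case: ifP. Qed.

Lemma card_wt a : #|[set t | wt t == a]| = 'C(n, a).
Proof.
rewrite -[RHS](congr1 (binomial^~ a) (card_ord n)) -card_draws
  -(card_imset _ (can_inj indicK)).
apply: eq_card => t; rewrite inE; apply/idP/imsetP => [/eqP <-|[A]].
  by exists (ones t); rewrite ?onesK // inE val_wt.
by rewrite inE => /eqP Aa ->; apply/eqP/val_inj; rewrite /= val_wt indicK.
Qed.

Lemma wt_surj a : exists t, wt t == a.
Proof.
have /card_gt0P[t] : (0 < #|[set t | wt t == a]|)%N.
  by rewrite card_wt bin_gt0 -ltnS.
by rewrite inE; exists t.
Qed.

Definition rep a : slot := xchoose (wt_surj a).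

Lemma wt_rep a : wt (rep a) = a.
Proof. exact/eqP/(xchooseP (wt_surj a)). Qed.

(** Permutations act transitively on the indices of a given weight, which is why a symmetric tensor
    is a function of the weight. With only two values available, the number of ones determines the
    multiset of values. *)
Lemma wt_perm t t' : wt t = wt t' -> exists p : 'S_n, t' = [ffun i => t (p i)].
Proof.
move=> tt'; have card_ones : #|ones t| = #|ones t'| by rewrite -!val_wt tt'.
have countE (x : pred 'I_2) t0 : count x [tuple t0 i | i < n] =
    (#|ones t0| * x ord_max + (n - #|ones t0|) * x ord0)%N.
  rewrite /= count_map -sum1_count big_mkcond /= big_enum /=.
  rewrite -card_onesC (bigID (mem (ones t0))) /= -!sum_nat_const.
  congr (_ + _)%N; last first.
    apply: eq_big => i; first by rewrite !inE.
    by rewrite !inE negbK => /eqP->; case: (x _).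
  by apply: eq_bigr => i; rewrite inE => /ord2_neq0->; case: (x _).
have /tuple_permP[p pE] : perm_eq [tuple t' i | i < n] [tuple t i | i < n].
  by apply/seq.permP => x; rewrite !countE card_ones.
exists p; apply/ffunP => i; rewrite ffunE.
have := congr1 (fun x => nth ord0 x i) pE.
by rewrite -!tnth_nth !tnth_mktuple.
Qed.

Definition flip t : slot := [ffun k => rev_ord (t k)].

Lemma wt_flip t : wt (flip t) = bar (wt t).
Proof.
apply: val_inj; rewrite /= !val_wt subSS -card_onesC.
apply: eq_card => k; rewrite !inE ffunE.
by case: (t k) => -[|[|]].
Qed.

End Weights.

(** * From tensors on positions to functions of words *)

Section Transfer.
Variables (R : realType) (n : nat).
Local Notation C := (complex R).
Local Notation K := (complex R : numClosedFieldType).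
Local Notation I := 'I_n.+1.
Local Notation slot := {ffun 'I_n -> 'I_2}.
Local Notation tensor := (seq I -> C).
Local Notation bitensor := (seq I -> seq I -> C).
Implicit Types (a b d : I) (u v w : seq I) (X Y W : bitensor) (f : tensor).
Implicit Type g : 'M[C]_2.

Definition factor m (t : {ffun pos n m -> 'I_2}) (i : 'I_m) : slot := [ffun k => t (i, k)].
Definition word m (t : {ffun pos n m -> 'I_2}) : seq I :=
  [seq wt (factor t i) | i <- enum 'I_m].

Definition J m f : sp R (pos n m) := [ffun t : {ffun pos n m -> 'I_2} => f (word t)].

Definition lpart k l (t : {ffun pos n k + pos n l -> 'I_2}) : {ffun pos n k -> 'I_2} :=
  [ffun p => t (inl p)].
Definition rpart k l (t : {ffun pos n k + pos n l -> 'I_2}) : {ffun pos n l -> 'I_2} :=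
  [ffun p => t (inr p)].

(** The left word is reversed so that both words start at the junction. *)
Definition J2 k l X : sp R (pos n k + pos n l)%type :=
  [ffun t : {ffun pos n k + pos n l -> 'I_2} => X (rev (word (lpart t))) (word (rpart t))].

Lemma size_word m (t : {ffun pos n m -> 'I_2}) : size (word t) = m.
Proof. by rewrite size_map size_enum_ord. Qed.

Lemma nth_word m (t : {ffun pos n m -> 'I_2}) (i : 'I_m) :
  nth ord0 (word t) i = wt (factor t i).
Proof. by rewrite (nth_map i) ?size_enum_ord // nth_ord_enum. Qed.

Definition wrep m w : {ffun pos n m -> 'I_2} := [ffun p : pos n m => rep (nth ord0 w p.1) p.2].

Lemma word_wrep m w : size w = m -> word (wrep m w) = w.
Proof.
move=> wm; apply: (@eq_from_nth _ ord0); rewrite size_word // => i im.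
rewrite (nth_word _ (Ordinal im)) -[RHS]wt_rep; congr wt.
by apply/ffunP => k; rewrite !ffunE.
Qed.

Lemma J_inj m f f' w : J m f = J m f' -> size w = m -> f w = f' w.
Proof. by move=> /ffunP /(_ (wrep m w)); rewrite !ffunE => + wm; rewrite word_wrep. Qed.

Lemma J_ext m f f' : (forall w, size w = m -> f w = f' w) -> J m f = J m f'.
Proof. by move=> ff; apply/ffunP => t; rewrite !ffunE ff ?size_word. Qed.

Lemma wsum_pick k w0 f : size w0 = k -> wsum (K := K) k (fun w => (w == w0)%:R * f w) = f w0.
Proof.
elim: k w0 f => [|k IH] [|a w0] f //=; first by rewrite mul1r.
move=> [wk]; rewrite -[RHS](sum_pick a (fun b => f (b :: w0))).
apply: eq_bigr => b _; rewrite -[f (b :: w0)]/(sub b f w0) -(IH w0 (sub b f)) // -wsumZ.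
apply: wsum_ext => w _; rewrite /sub eqseq_cons.
by case: (b == a); rewrite ?mul0r ?mul1r.
Qed.

Lemma prod_bool (T : finType) (x : pred T) : \prod_i (x i)%:R = [forall i, x i]%:R :> C.
Proof.
case: forallP => [xT|/forallP]; first by rewrite big1 // => i _; rewrite xT.
by rewrite negb_forall => /existsP[i /negbTE xi]; rewrite (bigD1 i) //= xi mul0r.
Qed.

(** Grouping the indices by their word of weights factorises the sum row by row. With F = 1 it
    counts indices and yields the inner product; with the entries of g it yields the action. *)
Lemma sum_row m (F : 'I_m -> slot -> C) f :
  \sum_(t : {ffun pos n m -> 'I_2}) (\prod_i F i (factor t i)) * f (word t) =
  wsum (K := K) m (fun w => (\prod_(i < m) \sum_(s | wt s == nth ord0 w i) F i s) * f w).
Proof.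
under eq_bigr => t _ do rewrite -(wsum_pick f (size_word t)) -wsumZ.
rewrite -wsum_sum; apply: wsum_ext => w wm.
under [in RHS]eq_bigr do rewrite big_mkcond.
rewrite bigA_distr_bigA mulr_suml.
rewrite (reindex (fun T : {ffun 'I_m -> slot} => [ffun p : pos n m => T p.1 p.2])) /=.
  apply: eq_bigr => T _.
  have rowT i : factor [ffun p : pos n m => T p.1 p.2] i = T i.
    by apply/ffunP => k; rewrite !ffunE.
  rewrite mulrA; congr (_ * _).
  have -> : (w == word [ffun p : pos n m => T p.1 p.2])%:R =
      \prod_(i < m) (wt (T i) == nth ord0 w i)%:R :> C.
    rewrite prod_bool; congr ((nat_of_bool _)%:R); apply/eqP/forallP => [->|wT].
      by move=> i; rewrite nth_word rowT.
    apply: (@eq_from_nth _ ord0); rewrite ?size_word // wm => i im.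
    by rewrite (nth_word _ (Ordinal im)) rowT; apply/esym/eqP.
  rewrite -big_split; apply: eq_bigr => i _; rewrite /= rowT.
  by case: ifP; rewrite ?mulr1 ?mulr0.
exists (fun t => [ffun i => factor t i]) => t _; apply/ffunP.
  by move=> i; rewrite !ffunE; apply/ffunP => k; rewrite !ffunE.
by move=> [i k]; rewrite !ffunE.
Qed.

Lemma prod_nth (F : I -> C) m w : size w = m -> \prod_(i < m) F (nth ord0 w i) = \prod_(a <- w) F a.
Proof. by move=> <-; rewrite (big_nth ord0) big_mkord. Qed.

Lemma sum_word m f :
  \sum_(t : {ffun pos n m -> 'I_2}) f (word t) = wsum (K := K) m (fun w => wmass K w * f w).
Proof.
transitivity (\sum_(t : {ffun pos n m -> 'I_2}) (\prod_(i < m) 1) * f (word t)).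
  by apply: eq_bigr => t _; rewrite big1 ?mul1r.
rewrite (sum_row (fun _ _ => 1)); apply: wsum_ext => w wm; congr (_ * _).
rewrite /wmass -(prod_nth _ wm); apply: eq_bigr => i _.
by rewrite sumr_const /mass -card_wt cardsE.
Qed.

Lemma sum_parts k l (F : {ffun pos n k -> 'I_2} -> {ffun pos n l -> 'I_2} -> C) :
  \sum_(t : {ffun pos n k + pos n l -> 'I_2}) F (lpart t) (rpart t) =
  \sum_t1 \sum_t2 F t1 t2.
Proof.
rewrite pair_big (reindex (fun t : {ffun pos n k + pos n l -> 'I_2} => (lpart t, rpart t))) //=.
exists (fun p : {ffun pos n k -> 'I_2} * {ffun pos n l -> 'I_2} =>
  [ffun x : (pos n k + pos n l)%type => match x with inl y => p.1 y | inr y => p.2 y end]) => [t _|[t1 t2] _].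
  by apply/ffunP => -[p|p]; rewrite !ffunE.
by congr pair; apply/ffunP => p; rewrite !ffunE.
Qed.

Lemma dot_J m f f' : dot (J m f) (J m f') = wdot (K := K) m f f'.
Proof.
rewrite /dot; under eq_bigr do rewrite !ffunE.
rewrite (sum_word m (fun w => f w * conjc (f' w))); apply: wsum_ext => w _.
by rewrite mulrA.
Qed.

Lemma dot_J2 k l X Y : dot (J2 k l X) (J2 k l Y) = dot2 (K := K) k l X Y.
Proof.
rewrite /dot; under eq_bigr do rewrite !ffunE.
rewrite (sum_parts (fun t1 t2 => X (rev (word t1)) (word t2) *
  conjc (Y (rev (word t1)) (word t2)))).
under eq_bigr => t1 _ do rewrite (sum_word l (fun w => X (rev (word t1)) w *
  conjc (Y (rev (word t1)) w))).
rewrite (sum_word k (fun u => wsum l (fun w => wmass K w * (X (rev u) w * conjc (Y (rev u) w))))).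
rewrite -wsum_rev; apply: wsum_ext => u _; rewrite revK wmass_rev; congr (_ * _).
by apply: wsum_ext => w _; rewrite mulrA.
Qed.

Definition slot_coef g (t s : slot) := \prod_k g (t k) (s k).
Definition weight_mx g a b := \sum_(s | wt s == b) slot_coef g (rep a) s.

(** Independence of the representative: indices of equal weight differ by a permutation of the
    slots, which can be moved onto the summation variable. *)
Lemma weight_mxE g t b : \sum_(s | wt s == b) slot_coef g t s = weight_mx g (wt t) b.
Proof.
have [p repE] : exists p : 'S_n, rep (wt t) = [ffun i => t (p i)].
  by apply: wt_perm; rewrite wt_rep.
rewrite /weight_mx repE.
rewrite [RHS](reindex (fun s : slot => [ffun i => s (p i)])) /=.
  apply: eq_big => s.
    congr (_ == _); apply: val_inj; rewrite /= !val_wt -(card_preimset _ (@perm_inj _ p)).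
    by apply: eq_card => i; rewrite !inE ffunE.
  move=> _; rewrite /slot_coef (reindex_inj (@perm_inj _ p)).
  by apply: eq_bigr => i _; rewrite !ffunE.
exists (fun s : slot => [ffun i => s ((p^-1)%g i)]) => s _; apply/ffunP => i;
  by rewrite !ffunE ?permK ?permKV.
Qed.

Lemma actE (U : I -> I -> C) f w :
  act (K := K) U f w =
  wsum (K := K) (size w) (fun w' =>
    (\prod_(i < size w) U (nth ord0 w i) (nth ord0 w' i)) * f w').
Proof.
elim: w f => [|a w IH] f /=; first by rewrite big_ord0 mul1r.
apply: eq_bigr => b _; rewrite IH -wsumZ; apply: wsum_ext => w' _.
by rewrite /sub big_ord_recl /= mulrA.
Qed.

Lemma tact_sum m g (f : tensor) (t : {ffun pos n m -> 'I_2}) :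
  \sum_(t' : {ffun pos n m -> 'I_2}) (\prod_p g (t p) (t' p)) * f (word t') =
  act (K := K) (weight_mx g) f (word t).
Proof.
transitivity (\sum_(t' : {ffun pos n m -> 'I_2})
    (\prod_(i < m) slot_coef g (factor t i) (factor t' i)) * f (word t')).
  apply: eq_bigr => t' _; congr (_ * _).
  by rewrite /slot_coef pair_bigA; apply: eq_bigr => -[i k] _; rewrite !ffunE.
rewrite (sum_row (fun i => slot_coef g (factor t i))) actE size_word.
apply: wsum_ext => w _; congr (_ * _); apply: eq_bigr => i _.
by rewrite nth_word weight_mxE.
Qed.

Lemma tact_J m g f : tact g (J m f) = J m (act (K := K) (weight_mx g) f).
Proof.
apply/ffunP => t; rewrite !ffunE -tact_sum.
by apply: eq_bigr => t' _; rewrite ffunE.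
Qed.

Lemma tact_J2 k l g X : tact g (J2 k l X) = J2 k l (act2 (K := K) (weight_mx g) X).
Proof.
apply/ffunP => t; rewrite !ffunE.
pose F (t1 : {ffun pos n k -> 'I_2}) (t2 : {ffun pos n l -> 'I_2}) :=
  (\prod_p g (lpart t p) (t1 p)) *
  ((\prod_p g (rpart t p) (t2 p)) * X (rev (word t1)) (word t2)).
transitivity (\sum_(t' : {ffun pos n k + pos n l -> 'I_2}) F (lpart t') (rpart t')).
  apply: eq_bigr => t' _; rewrite ffunE /F mulrA big_sumType; congr (_ * _ * _);
    by apply: eq_bigr => p _; rewrite !ffunE.
rewrite sum_parts /F.
under eq_bigr do rewrite -mulr_sumr tact_sum.
rewrite (tact_sum g (fun u => act (K := K) (weight_mx g) (X (rev u)) (word (rpart t)))).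
exact: (act_rev (K := K) (weight_mx g) (fun u => act (K := K) (weight_mx g) (X u) (word (rpart t)))).
Qed.

End Transfer.

(** * Invariance of the cup and cap *)

Section Invariants.
Variables (R : realType) (n : nat).
Local Notation C := (complex R).
Local Notation K := (complex R : numClosedFieldType).
Local Notation I := 'I_n.+1.
Local Notation slot := {ffun 'I_n -> 'I_2}.
Local Notation s := (@cap_coef K n).
Local Notation q := (@cup_coef K n).
Local Notation U := (@weight_mx R n).
Implicit Types (a b d : I) (t : slot).
Implicit Type g : 'M[C]_2.

Lemma big_I2 (F : 'I_2 -> C) : \sum_i F i = F ord0 + F ord_max.
Proof. by rewrite big_ord_recl big_ord1; congr (_ + F _); apply: val_inj. Qed.

(** The identity g^T eps g = det(g) eps for the skew form eps on C^2. *)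
Lemma det_skew g (i j : 'I_2) : \det g = 1 ->
  \sum_(b : 'I_2) (-1) ^+ b * g b i * g (rev_ord b) j = (-1) ^+ i * (j == rev_ord i)%:R.
Proof.
have rev0 : rev_ord (ord0 : 'I_2) = ord_max by apply: val_inj.
have rev1 : rev_ord (ord_max : 'I_2) = ord0 by apply: val_inj.
move=> g1; have dg : g ord0 ord0 * g ord_max ord_max - g ord0 ord_max * g ord_max ord0 = 1.
  rewrite -g1 (expand_det_row _ ord0) big_I2 /cofactor !det_mx11 !mxE /= mulN1r mulrN mul1r.
  by congr (_ * g _ _ - _ * g _ _); apply: val_inj.
rewrite big_I2 rev0 rev1 /= !expr0 expr1 -mulrA !mul1r mulN1r mulNr.
case: (eqVneq i ord0) => [->|/ord2_neq0->]; rewrite ?rev0 ?rev1;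
  case: (eqVneq j ord0) => [->|/ord2_neq0->] /=.
- by rewrite mulr0 mulrC subrr.
- by rewrite expr0 mulr1 -dg; congr (_ - _); rewrite mulrC.
- by rewrite expr1 mulr1 -dg; ring.
- by rewrite mulr0 mulrC subrr.
Qed.

Lemma exp_wt (x : C) t : x ^+ wt t = \prod_k x ^+ (t k).
Proof.
rewrite val_wt -prodr_const big_mkcond.
apply: eq_bigr => k _; rewrite inE; case: eqVneq => [->|/ord2_neq0->] //.
Qed.

(** The n-th tensor power of [det_skew]: the sign and both coefficients are products over the
    slots. *)
Lemma slot_skew g t t' : \det g = 1 ->
  \sum_(r : slot) (-1) ^+ wt r * slot_coef g r t * slot_coef g (flip r) t' =
  (-1) ^+ wt t * (t' == flip t)%:R.
Proof.
move=> g1.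
transitivity (\prod_k \sum_(b : 'I_2) (-1) ^+ b * g b (t k) * g (rev_ord b) (t' k)).
  rewrite bigA_distr_bigA; apply: eq_bigr => r _.
  rewrite exp_wt /slot_coef -!big_split; apply: eq_bigr => k _.
  by rewrite /= ffunE.
under eq_bigr do rewrite det_skew //.
rewrite big_split /= -exp_wt prod_bool; congr (_ * (nat_of_bool _)%:R).
apply/forallP/eqP => [tt'|-> k]; last by rewrite ffunE.
by apply/ffunP => k; rewrite ffunE; exact/eqP/tt'.
Qed.

Lemma sum_wt (F : I -> slot -> C) :
  \sum_t F (wt t) t = \sum_a \sum_(t | wt t == a) F a t.
Proof.
rewrite (partition_big (@wt n) predT) //=; apply: eq_bigr => a _.
by apply: eq_bigr => t /eqP->.
Qed.

Lemma sum_wt_const a (c : C) : \sum_(t | wt t == a) c = mass K a * c.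
Proof. by rewrite sumr_const -cardsE card_wt /mass mulr_natl. Qed.

(** Sum [slot_skew] over all t of weight b and t' of weight d. Grouping r by its weight a produces
    the binomial in [cap_coef] on the left; counting t produces it on the right. *)
Lemma weight_cap g b d : \det g = 1 ->
  \sum_a s a * U g a b * U g (bar a) d = s b * (d == bar b)%:R.
Proof.
move=> g1.
transitivity (\sum_(t | wt t == b) \sum_(t' | wt t' == d)
   \sum_(r : slot) (-1) ^+ wt r * slot_coef g r t * slot_coef g (flip r) t').
  under [RHS]eq_bigr do rewrite exchange_big.
  rewrite exchange_big /=.
  transitivity (\sum_(r : slot) (-1) ^+ wt r * U g (wt r) b * U g (bar (wt r)) d).
    rewrite (sum_wt (fun a _ => (-1) ^+ a * U g a b * U g (bar a) d)).
    apply: eq_bigr => a _; rewrite sum_wt_const !mulrA /cap_coef.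
    by rewrite (mulrC (mass K a)).
  apply: eq_bigr => r _; rewrite -wt_flip -!weight_mxE -mulrA mulr_suml mulr_sumr.
  apply: eq_bigr => t _; rewrite mulr_sumr mulr_sumr.
  by apply: eq_bigr => t' _; rewrite mulrA.
under eq_bigr => t _ do under eq_bigr do rewrite slot_skew //.
transitivity (\sum_(t | wt t == b) (-1) ^+ b * (d == bar b)%:R : C).
  apply: eq_bigr => t /eqP tb; rewrite -mulr_sumr tb; congr (_ * _).
  rewrite -tb -wt_flip big_mkcond (bigD1 (flip t)) //= eqxx big1 => [|t' /negbTE->].
    by rewrite addr0 eq_sym; case: eqP.
  by rewrite if_same.
by rewrite sum_wt_const mulrCA mulrA.
Qed.

Definition cap_mx : 'M[C]_n.+1 := \matrix_(a, c) (s a * (c == bar a)%:R).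
Definition cup_mx : 'M[C]_n.+1 := \matrix_(a, c) (q a * (c == bar a)%:R).
Definition U_mx g : 'M[C]_n.+1 := \matrix_(a, b) U g a b.

Lemma cap_cup_mx : cap_mx *m cup_mx^T = 1%:M.
Proof.
apply/matrixP => a d; rewrite !mxE.
transitivity (\sum_c (c == bar a)%:R * (s a * q d * (c == bar d)%:R)).
  by apply: eq_bigr => c _; rewrite !mxE; ring.
rewrite sum_pick (inj_eq (inv_inj (@barK n))).
by case: eqVneq => [->|_]; rewrite ?mulr0 // mulr1 cap_cup.
Qed.

Lemma cap_mxE g : \det g = 1 -> (U_mx g)^T *m cap_mx *m U_mx g = cap_mx.
Proof.
move=> g1; apply/matrixP => b d; rewrite [RHS]mxE -(weight_cap b d g1) !mxE.
rewrite -(sum_bar (fun c => _)); apply: eq_bigr => a _; rewrite !mxE.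
rewrite (bigD1 a) //= !mxE eqxx big1 => [|c ca]; first by rewrite addr0 mulr1 (mulrC (U g a b)).
by rewrite !mxE (inj_eq (inv_inj (@barK n))) eq_sym (negbTE ca) !mulr0.
Qed.

(** The transpose of [cup_mx] is inverse to [cap_mx], so invariance of the form exhibits a left
    inverse of [U_mx g]. It is also a right inverse, and this is the invariance of delta. *)
Lemma cup_mxE g : \det g = 1 -> U_mx g *m cup_mx *m (U_mx g)^T = cup_mx.
Proof.
move=> g1; have c1 := mulmx1C cap_cup_mx.
have /mulmx1C UV : (cup_mx^T *m (U_mx g)^T *m cap_mx) *m U_mx g = 1%:M.
  by rewrite -!mulmxA (mulmxA _ _ (U_mx g)) cap_mxE.
apply: trmx_inj; rewrite !trmx_mul trmxK -[RHS]mul1mx -UV -!mulmxA.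
by rewrite cap_cup_mx mulmx1 !mulmxA.
Qed.

Lemma weight_cup g a d : \det g = 1 ->
  \sum_b U g a b * q b * U g d (bar b) = q a * (d == bar a)%:R.
Proof.
move=> /cup_mxE /matrixP /(_ a d); rewrite !mxE => <-.
rewrite -[RHS](sum_bar (fun c => _)); apply: eq_bigr => b _; rewrite !mxE.
rewrite (bigD1 b) //= !mxE eqxx big1 => [|c cb]; first by rewrite addr0 mulr1.
by rewrite !mxE (inj_eq (inv_inj (@barK n))) eq_sym (negbTE cb) !mulr0.
Qed.

(* The powers of 3 + 4i are all congruent to 3 + 4i modulo 5, so (3 + 4i)/5 is
   not a root of unity. *)
Definition zeta : C := (3%:R + 4%:R * 'i) / 5%:R.

Lemma zeta_norm : zeta * zeta^* = 1.
Proof.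
rewrite /zeta rmorphM rmorphD rmorphM fmorphV /= !conjC_nat conjCi.
have i2 : 'i * 'i = -1 :> C by rewrite -expr2 sqrCi.
have five : (5%:R : C) != 0 by rewrite pnatr_eq0.
have -> : (3%:R + 4%:R * 'i) / 5%:R * ((3%:R + 4%:R * - 'i) / 5%:R) =
  (9%:R - 16%:R * ('i * 'i)) / (5%:R * 5%:R) :> C by field.
by rewrite i2; field.
Qed.

Lemma zeta_exp k : exists x y : int,
  zeta ^+ k.+1 * 5%:R ^+ k.+1 = (5 * x + 3)%:~R + (5 * y + 4)%:~R * 'i.
Proof.
have five : (5%:R : C) != 0 by rewrite pnatr_eq0.
elim: k => [|k [x [y IH]]].
  by exists 0, 0; rewrite !expr1 /zeta divfK // !mulr0 !add0r.
(* The constants come from (3 + 4i)^2 = -7 + 24i = 5 (-2 + 4i) + (3 + 4i). *)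
exists (3 * x - 4 * y - 2), (4 * x + 3 * y + 4).
rewrite [zeta ^+ _]exprSr [5%:R ^+ _]exprSr mulrACA IH /zeta divfK //.
have i2 : 'i * 'i = -1 :> C by rewrite -expr2 sqrCi.
have -> : ((5 * x + 3)%:~R + (5 * y + 4)%:~R * 'i) * (3%:R + 4%:R * 'i) =
  (5 * x + 3)%:~R * 3%:R + (5 * y + 4)%:~R * 4%:R * ('i * 'i) +
  ((5 * x + 3)%:~R * 4%:R + (5 * y + 4)%:~R * 3%:R) * 'i :> C by ring.
by rewrite i2; ring.
Qed.

Lemma zeta_neq1 k : (0 < k)%N -> zeta ^+ k != 1.
Proof.
case: k => [//|k] _; apply/eqP => z1; have [x [y]] := zeta_exp k.
(* If the power were 1, the imaginary part of a power of 5 would be 5 y + 4, which is never 0. *)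
rewrite z1 mul1r mulrC => /(congr1 (fun z : C => 'Im z)).
rewrite (Creal_ImP _ _) ?rpredX ?realn // [_ * 'i]mulrC Im_rect ?realz //.
by move=> /esym/eqP; rewrite intr_eq0; lia.
Qed.

Definition su2 (x y : C) : 'M[C]_2 :=
  \matrix_(i, j) if i == ord0 then (if j == ord0 then x else y)
                 else (if j == ord0 then - y^* else x^*).

Lemma ord2P (i : 'I_2) : i = ord0 \/ i = ord_max.
Proof. by case: (eqVneq i ord0) => [|/ord2_neq0]; [left|right]. Qed.

Lemma su2P x y : x * x^* + y * y^* = 1 -> SU2 (su2 x y).
Proof.
move=> xy; split; last first.
  rewrite (expand_det_row _ ord0) big_I2 /cofactor !det_mx11 !mxE /= mulN1r !mul1r.
  by rewrite mulrN mulrN opprK.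
apply/matrixP => i j; rewrite !mxE big_I2 !mxE.
have cK (z : C) : conjc (z^*) = z by exact: conjCK.
case: (ord2P i) => ->; case: (ord2P j) => -> //=; rewrite ?rmorphN /= ?cK //.
- by rewrite mulrN (mulrC y) addNr.
- by rewrite mulNr (mulrC x^*) addrC mulrC subrr.
by rewrite mulrNN [_ * y]mulrC [_ * x]mulrC addrC.
Qed.

(** The matrix is diagonal with entries z^(n - 2a); the factor z^(2a) avoids negative exponents. *)
Lemma torus_weight z a b : z * z^* = 1 ->
  U (su2 z 0) a b * (z ^+ 2) ^+ a = (b == a)%:R * z ^+ n.
Proof.
move=> z1; have diag (i j : 'I_2) : i != j -> su2 z 0 i j = 0.
  rewrite mxE rmorph0 oppr0.
  by case: (ord2P i) => ->; case: (ord2P j) => ->.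
have coef0 r t : r != t -> slot_coef (su2 z 0) t r = 0.
  move=> rt; have [k rtk] : exists k, t k != r k.
    apply/existsP; rewrite -negb_forall; apply: contraNN rt => /forallP rt.
    by apply/eqP/ffunP => k; apply/esym/eqP.
  by rewrite /slot_coef (bigD1 k) //= diag // mul0r.
rewrite /weight_mx big_mkcond (bigD1 (rep a)) //= big1 => [|r ra]; last first.
  by rewrite coef0 // if_same.
rewrite addr0 wt_rep eq_sym; case: eqP => _; last by rewrite !mul0r.
rewrite mul1r -{3}(wt_rep a) exp_wt /slot_coef -big_split /=.
transitivity (\prod_(k < n) z); last by rewrite prodr_const card_ord.
apply: eq_bigr => k _; rewrite mxE; case: (eqVneq _ ord0) => [->|/ord2_neq0->] /=.
  by rewrite expr0 mulr1.
by rewrite -[RHS]mul1r -z1 expr1 expr2 mulrA; congr (_ * _); exact: mulrC.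
Qed.

(** At weight 0 only the first row (3/5, 4/5) of the rotation enters, so the entry is a nonempty sum
    of products of positive numbers. *)
Lemma rotation_weight b : U (su2 (3%:R / 5%:R) (4%:R / 5%:R)) ord0 b != 0.
Proof.
have ones_rep0 : ones (rep (ord0 : I)) = set0.
  by apply/eqP; rewrite -cards_eq0 -val_wt wt_rep.
have coef_gt0 (r : slot) : 0 < slot_coef (su2 (3%:R / 5%:R) (4%:R / 5%:R)) (rep (ord0 : I)) r.
  apply: prodr_gt0 => k _.
  have -> : rep (ord0 : I) k = ord0.
    by have : k \notin ones (rep (ord0 : I)) by [rewrite ones_rep0 inE]; rewrite inE => /negbNE/eqP.
  by rewrite mxE eqxx; case: ifP => _; rewrite divr_gt0 ?ltr0n.
rewrite gt_eqF // /weight_mx (bigD1 (rep b)) ?wt_rep //= ltr_wpDr //.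
by apply: sumr_ge0 => r _; apply: ltW.
Qed.

(* [M *m cap_mx^T] commutes with all [U_mx g].  A torus element with distinct
   weights makes it diagonal, and then a rotation whose first row has no zero
   entry makes it scalar. *)
Lemma invariant_cup (M : 'M[C]_n.+1) :
  (forall g, SU2 g -> U_mx g *m M *m (U_mx g)^T = M) -> exists c, M = c *: cup_mx.
Proof.
move=> invM; pose A := M *m cap_mx^T.
have commA g : SU2 g -> A *m U_mx g = U_mx g *m A.
  move=> Sg; have := cap_mxE Sg.2 => /(congr1 (@trmx _ _ _)).
  rewrite !trmx_mul trmxK => capT.
  by rewrite /A -{1}(invM g Sg) -[in RHS]capT !mulmxA.
have z_neq0 : zeta != 0.
  by apply/eqP => z0; have := zeta_norm; rewrite z0 mul0r => /esym/eqP; rewrite oner_eq0.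
have diagA a b : a != b -> A a b = 0.
  move=> ab; have Sz : SU2 (su2 zeta 0).
    by apply: su2P; rewrite zeta_norm mul0r addr0.
  have /matrixP/(_ a b) := commA _ Sz; rewrite !mxE.
  have Uz c e : c != e -> U (su2 zeta 0) c e = 0.
    move=> ce; have := torus_weight c e zeta_norm.
    rewrite eq_sym (negbTE ce) mul0r => /eqP; rewrite mulf_eq0 expf_eq0 expf_eq0.
    by rewrite (negbTE z_neq0) !andbF orbF => /eqP.
  rewrite (bigD1 b) //= big1 => [|c cb]; last by rewrite !mxE Uz ?mulr0.
  rewrite [RHS](bigD1 a) //= big1 => [|c ca]; last by rewrite !mxE Uz ?mul0r // eq_sym.
  rewrite !mxE !addr0 => /eqP; rewrite mulrC -subr_eq0 -mulrBl mulf_eq0.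
  case/orP => [/eqP Uab|/eqP //].
  have ta := torus_weight a a zeta_norm; have tb := torus_weight b b zeta_norm.
  rewrite !eqxx !mul1r in ta tb.
  have Ub : U (su2 zeta 0) b b != 0.
    by apply/eqP => U0; move: tb; rewrite U0 mul0r => /esym/eqP; rewrite expf_eq0 (negbTE z_neq0) andbF.
  have zab : zeta ^+ 2 ^+ a = zeta ^+ 2 ^+ b.
    by apply: (mulfI Ub); rewrite tb -ta (subr0_eq Uab).
  have lt_false (c e : I) : (c < e)%N -> zeta ^+ 2 ^+ c = zeta ^+ 2 ^+ e -> False.
    move=> ce; rewrite -(subnKC (ltnW ce)) exprD -[X in X = _]mulr1.
    move/(mulfI (expf_neq0 _ (expf_neq0 _ z_neq0)))/esym/eqP.
    by rewrite -exprM (negbTE (zeta_neq1 _)) // muln_gt0 subn_gt0.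
  case: (ltngtP a b) => [ab'|ba|/val_inj aeb].
  - by case: (lt_false _ _ ab' zab).
  - by case: (lt_false _ _ ba (esym zab)).
  - by rewrite aeb eqxx in ab.
have constA b : A b b = A ord0 ord0.
  pose g := su2 (3%:R / 5%:R) (4%:R / 5%:R).
  have Sg : SU2 g.
    apply: su2P; have five : (5%:R : C) != 0 by rewrite pnatr_eq0.
    by rewrite !rmorphM !fmorphV /= !conjC_nat; field.
  have /matrixP/(_ ord0 b) := commA _ Sg; rewrite !mxE.
  rewrite (bigD1 ord0) //= big1 => [|c c0]; last by rewrite diagA ?mul0r // eq_sym.
  rewrite [RHS](bigD1 b) //= big1 => [|c cb]; last by rewrite diagA ?mulr0.
  rewrite !mxE !addr0 mulrC; move/(mulfI (rotation_weight b)) => -> //.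
exists (A ord0 ord0).
have capTcup : cap_mx^T *m cup_mx = 1%:M.
  by rewrite -[cup_mx]trmxK -trmx_mul (mulmx1C cap_cup_mx) trmx1.
rewrite -[M]mulmx1 -capTcup mulmxA -/A -mul_scalar_mx; congr (_ *m _).
apply/matrixP => a b; rewrite [RHS]mxE; case: eqVneq => [->|ab]; first by rewrite constA.
by rewrite diagA.
Qed.

End Invariants.

(** * Spans, inner product and action on arbitrary positions *)

Section Tensors.
Variable R : realType.
Local Notation C := (complex R).
Variable A : finType.
Implicit Types (x y z : sp R A) (c : C).

Lemma inspan_closed (P Q : sp R A -> Prop) : Q 0 ->
  (forall c x y, Q x -> Q y -> Q (scl c x + y)) ->
  (forall x, P x -> Q x) -> forall x, inspan P x -> Q x.
Proof.
move=> Q0 QD PQ x [r [Pr ->]]; elim: r Pr => [|p r IH] Pr; first by rewrite big_nil.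
rewrite big_cons; apply: QD; first by apply/PQ/Pr; rewrite mem_head.
by apply: IH => p' p'r; apply: Pr; rewrite in_cons p'r orbT.
Qed.

Lemma inspan_sum (P : sp R A -> Prop) (T : finType) (c : T -> C) (y : T -> sp R A) :
  (forall i, P (y i)) -> inspan P (\sum_i scl (c i) (y i)).
Proof.
move=> Py; exists [seq (c i, y i) | i <- enum T]; split.
  by move=> p /mapP[i _ ->]; exact: Py.
by rewrite big_map big_enum.
Qed.

Lemma inspan1 (P : sp R A -> Prop) x : P x -> inspan P x.
Proof.
move=> Px; exists [:: (1, x)]; split=> [p|]; first by rewrite inE => /eqP->.
by rewrite big_seq1; apply/ffunP => t; rewrite ffunE mul1r.
Qed.

Lemma dot_linl c x y z : dot (scl c x + y) z = c * dot x z + dot y z.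
Proof.
rewrite /dot mulr_sumr -big_split; apply: eq_bigr => t _.
by rewrite !ffunE mulrDl mulrA.
Qed.

Lemma dot_linr c x y z : dot z (scl c x + y) = c^* * dot z x + dot z y.
Proof.
rewrite /dot mulr_sumr -big_split; apply: eq_bigr => t _.
by rewrite !ffunE rmorphD rmorphM /= mulrDr mulrCA.
Qed.

Lemma dotr0 x : dot x 0 = 0.
Proof. by rewrite /dot big1 // => t _; rewrite ffunE rmorph0 mulr0. Qed.

Lemma dotl0 x : dot 0 x = 0.
Proof. by rewrite /dot big1 // => t _; rewrite ffunE mul0r. Qed.

Lemma dot_suml (T : Type) (r : seq T) (y : T -> sp R A) z :
  dot (\sum_(i <- r) y i) z = \sum_(i <- r) dot (y i) z.
Proof.
rewrite /dot [RHS]exchange_big; apply: eq_bigr => t _.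
by rewrite sum_ffunE mulr_suml.
Qed.

Lemma dot_sumr (T : Type) (r : seq T) (y : T -> sp R A) z :
  dot z (\sum_(i <- r) y i) = \sum_(i <- r) dot z (y i).
Proof.
rewrite /dot [RHS]exchange_big; apply: eq_bigr => t _.
by rewrite sum_ffunE rmorph_sum mulr_sumr.
Qed.

Lemma dot_ge0 x : 0 <= dot x x.
Proof. by apply: sumr_ge0 => t _; exact: mul_conjC_ge0. Qed.

Lemma dot_eq0 x : dot x x = 0 -> x = 0.
Proof.
move/eqP; rewrite psumr_eq0 => [|t _]; last exact: mul_conjC_ge0.
move=> /allP x0; apply/ffunP => t; rewrite ffunE; apply/eqP.
by rewrite -mul_conjC_eq0; apply: (implyP (x0 t _)) => //; rewrite mem_index_enum.
Qed.

Lemma tact_sum_sp (T : Type) (r : seq T) g (y : T -> sp R A) :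
  tact g (\sum_(i <- r) y i) = \sum_(i <- r) tact g (y i).
Proof.
apply/ffunP => t; rewrite sum_ffunE ffunE.
under [RHS]eq_bigr do rewrite ffunE.
rewrite [RHS]exchange_big; apply: eq_bigr => t' _.
by rewrite sum_ffunE mulr_sumr.
Qed.

Lemma tact_scl g c x : tact g (scl c x) = scl c (tact g x).
Proof.
apply/ffunP => t; rewrite !ffunE mulr_sumr; apply: eq_bigr => t' _.
by rewrite ffunE mulrCA.
Qed.

End Tensors.

(** * The spaces E_m as kernels of contractions *)

Section SubproductModel.
Variables (R : realType) (n : nat).
Local Notation C := (complex R).
Local Notation K := (complex R : numClosedFieldType).
Local Notation I := 'I_n.+1.
Local Notation slot := {ffun 'I_n -> 'I_2}.
Local Notation tensor := (seq I -> C).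
Local Notation bitensor := (seq I -> seq I -> C).
Local Notation s := (@cap_coef K n).
Local Notation q := (@cup_coef K n).
Implicit Types (a b d : I) (u v w : seq I) (X Y W : bitensor) (f h : tensor).
Implicit Type g : 'M[C]_2.

Lemma J_lin m c f h : scl c (J m f) + J m h = J m (fun w => c * f w + h w).
Proof. by apply/ffunP => t; rewrite !ffunE. Qed.

Lemma J2_lin k l c X Y :
  scl c (J2 k l X) + J2 k l Y = J2 k l (fun u v => c * X u v + Y u v).
Proof. by apply/ffunP => t; rewrite !ffunE. Qed.

Lemma J0 m : 0 = J m (fun=> 0 : C) :> sp R (pos n m).
Proof. by apply/ffunP => t; rewrite !ffunE. Qed.

Lemma J20 k l : 0 = J2 k l (fun _ _ => 0 : C) :> sp R (pos n k + pos n l)%type.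
Proof. by apply/ffunP => t; rewrite !ffunE. Qed.

Lemma Ln_wt (x : sp R 'I_n) (t : slot) : Ln x -> x t = x (rep (wt t)).
Proof.
move=> Lx; have [p ->] : exists p : 'S_n, rep (wt t) = [ffun i => t (p i)].
  by apply: wt_perm; rewrite wt_rep.
by rewrite -[in LHS](Lx p) ffunE.
Qed.

Lemma Ln_fun (h : I -> C) : Ln ([ffun t : slot => h (wt t)] : sp R 'I_n).
Proof.
move=> p; apply/ffunP => t; rewrite !ffunE; congr h; apply: val_inj.
rewrite /= !val_wt -(card_preimset (ones t) (@perm_inj _ p)).
by apply: eq_card => i; rewrite !inE ffunE.
Qed.

Lemma Lpow_J m (x : sp R (pos n m)) : Lpow x <-> exists f, x = J m f.
Proof.
split=> [|[f ->]].
  move: x; apply: inspan_closed => [|c _ _ [f ->] [h ->]|_ [vs [Lvs ->]]].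
  - by exists (fun=> 0); exact: J0.
  - by exists (fun w => c * f w + h w); exact: J_lin.
  exists (fun w => \prod_(i < m) vs i (rep (nth ord0 w i))).
  apply/ffunP => t; rewrite !ffunE; apply: eq_bigr => i _.
  by rewrite nth_word -Ln_wt.
(* Conversely, [J m f] is expanded in the elementary tensors of weight indicators, one for each
   word. *)
pose wd (w : {ffun 'I_m -> I}) := [seq w i | i <- enum 'I_m].
pose e (w : {ffun 'I_m -> I}) i : sp R 'I_n := [ffun t : slot => (wt t == w i)%:R].
rewrite (_ : J m f = \sum_w scl (f (wd w)) (etens (e w))).
  apply: inspan_sum => w; exists (e w); split=> // i.
  exact: (Ln_fun (fun a => (a == w i)%:R)).
apply/ffunP => t; rewrite sum_ffunE ffunE.
pose w0 := [ffun i => wt (factor t i)].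
transitivity (\sum_w (w == w0)%:R * f (wd w)).
  rewrite (bigD1 w0) //= eqxx mul1r big1 ?addr0 => [|w /negbTE->]; last by rewrite mul0r.
  by congr f; apply: eq_map => i; rewrite ffunE.
apply: eq_bigr => w _; rewrite !ffunE mulrC; congr (_ * _).
under eq_bigr do rewrite ffunE.
rewrite (prod_bool _ (fun i => wt (factor t i) == w i)); congr ((nat_of_bool _)%:R).
apply/eqP/forallP => [-> i|ww0]; first by rewrite ffunE.
by apply/ffunP => i; rewrite ffunE; apply/esym/eqP.
Qed.

Local Notation cup1 := (cup (fun=> 1 : C) : tensor).

Lemma word2 (t : {ffun pos n 2 -> 'I_2}) :
  word t = [:: wt (factor t ord0); wt (factor t ord_max)].
Proof.
apply: (@eq_from_nth _ ord0); rewrite size_word // => -[|[|//]] lt_i.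
  by rewrite (nth_word t ord0).
by rewrite (nth_word t ord_max).
Qed.

Lemma detL_cup1 : detL (J 2 cup1).
Proof.
split=> [|g [_ g1]]; first by apply/Lpow_J; exists cup1.
rewrite tact_J; apply: J_ext => w w2.
rewrite -(cup_act (fun a d => weight_cup a d g1)); apply: cup_ext => v.
by rewrite w2 => -[] /size0nil->.
Qed.

(** The coefficients of xi form a matrix M with U M U^T = M, to which [invariant_cup] applies. *)
Lemma detL_scl (xi : sp R (pos n 2)) : detL xi -> exists c, xi = scl c (J 2 cup1).
Proof.
case=> /Lpow_J[f ->] inv_f; pose M : 'M[C]_n.+1 := \matrix_(a, b) f [:: a; b].
have [|c ME] := @invariant_cup R n M.
  move=> g Sg; apply/matrixP => a b.
  have := inv_f g Sg; rewrite tact_J => /J_inj -/(_ [:: a; b] erefl) fE.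
  rewrite [RHS]mxE -fE /= !mxE.
  transitivity (\sum_d \sum_e weight_mx g a e * f [:: e; d] * weight_mx g b d).
    apply: eq_bigr => d _; rewrite !mxE mulr_suml.
    by apply: eq_bigr => e _; rewrite !mxE.
  rewrite exchange_big; apply: eq_bigr => e _; rewrite mulr_sumr.
  by apply: eq_bigr => d _; rewrite /sub -mulrA (mulrC (f _)).
exists c; apply/ffunP => t; rewrite !ffunE word2.
have := congr1 (fun B : 'M[C]_n.+1 => B (wt (factor t ord0)) (wt (factor t ord_max))) ME.
by rewrite !mxE => ->; rewrite /= mulr1.
Qed.

(** Pairing with a vector that has delta at two adjacent places is contracting there; this links
    orthogonality to K_m with [isE]. *)
Lemma wdot_contract m p r f h (H : seq I -> seq I -> C) : m = (p + r.+2)%N ->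
  (forall u v a b, size u = p -> size v = r ->
     h (u ++ [:: a, b & v]) = (b == bar a)%:R * (q a * H u v)) ->
  wdot (K := K) m f h =
  wsum (K := K) p (fun u => wsum (K := K) r (fun v =>
    wmass K u * (wmass K v * (H u v)^*) * \sum_a s a * f (u ++ [:: a, bar a & v]))).
Proof.
move=> -> hE; rewrite /wdot wsum_cat; apply: wsum_ext => u up /=.
under eq_bigr do rewrite -wsum_sum.
rewrite -wsum_sum; apply: wsum_ext => v vr; rewrite /sub mulr_sumr.
apply: eq_bigr => a _.
transitivity (\sum_b (b == bar a)%:R *
    (mass K a * mass K b * q a * (wmass K u * (wmass K v * (H u v)^*) * f (u ++ [:: a, b & v])))).
  apply: eq_bigr => b _; rewrite hE // wmass_cat !wmass_cons 2!rmorphM /= conj_cup.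
  by rewrite conjC_nat; ring.
by rewrite sum_pick mass_cup; ring.
Qed.

(** The letters [ord0] are placeholders at i and j, which the product skips. *)
Definition spectators m (i j : 'I_m) (vs : 'I_m -> sp R 'I_n) u v : C :=
  \prod_(x | (x != i) && (x != j)) vs x (rep (nth ord0 (u ++ [:: ord0, ord0 & v]) x)).

Lemma dot_ins2 m (i j : 'I_m) c vs f : val j = (val i).+1 -> (forall x, Ln (vs x)) ->
  dot (J m f) (ins2 i j (scl c (J 2 cup1)) vs) =
  wsum (K := K) i (fun u => wsum (K := K) (m - i.+2) (fun v =>
    wmass K u * (wmass K v * (c * spectators i j vs u v)^*) *
    \sum_a s a * f (u ++ [:: a, bar a & v]))).
Proof.
move=> ij Lvs; pose h w := c * cup1 [:: nth ord0 w i; nth ord0 w j] *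
  \prod_(x | (x != i) && (x != j)) vs x (rep (nth ord0 w x)).
have -> : ins2 i j (scl c (J 2 cup1)) vs = J m h.
  apply/ffunP => t; rewrite !ffunE word2 /h !nth_word; congr (_ * _); last first.
    by apply: eq_bigr => x _; rewrite nth_word -Ln_wt.
  by congr (_ * cup1 [:: wt _; wt _]); apply/ffunP => k; rewrite !ffunE.
have jm := ltn_ord j; rewrite dot_J.
apply: wdot_contract => [|u v a b ui vr].
  by move: jm; rewrite ij /=; lia.
have nth_i : nth ord0 (u ++ [:: a, b & v]) i = a by rewrite nth_cat ui ltnn subnn.
have nth_j : nth ord0 (u ++ [:: a, b & v]) j = b.
  by rewrite nth_cat ui ij ltnNge leqnSn /= subSnn.
rewrite /h nth_i nth_j /= mulr1 [RHS](_ : _ = c * (q a * (b == bar a)%:R) *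
  spectators i j vs u v); last by ring.
congr (_ * _); apply: eq_bigr => x /andP[xi xj]; congr (vs x (rep _)).
rewrite !nth_cat ui; case: ltnP => // ix.
have : (i.+1 < x)%N by rewrite ltn_neqAle -ij eq_sym xj ij ltn_neqAle eq_sym xi.
by move=> i1x; rewrite (_ : (x - i = (x - i.+2).+2)%N) //; move: i1x; clear; lia.
Qed.

Lemma E_J m f : isE f -> E (J m f).
Proof.
move=> Ef; split=> [|y]; first by apply/Lpow_J; exists f.
move: y; apply: inspan_closed => [|c x y x0 y0|x [i [j [xi [vs [ij Dxi Lvs ->]]]]]].
- exact: dotr0.
- by rewrite dot_linr x0 y0 mulr0 addr0.
have [c ->] := detL_scl Dxi; rewrite dot_ins2 //.
by apply: wsum_eq0 => u _; apply: wsum_eq0 => v _; rewrite Ef mulr0.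
Qed.

(** The value 0 off length m lets [isE] hold for words of every length. *)
Definition coords m (z : sp R (pos n m)) : tensor :=
  fun w => if size w == m then z (wrep m w) else 0.

Lemma coords_J m f w : coords (J m f) w = if size w == m then f w else 0.
Proof. by rewrite /coords; case: eqP => // wm; rewrite ffunE word_wrep. Qed.

Lemma J_coords m (x : sp R (pos n m)) : Lpow x -> J m (coords x) = x.
Proof.
by move=> /Lpow_J[f ->]; apply: J_ext => w wm; rewrite coords_J wm eqxx.
Qed.

Lemma spectators_indic m (i j : 'I_m) u0 v0 u v : val j = (val i).+1 ->
  size u0 = i -> size v0 = (m - i.+2)%N -> size u = i -> size v = (m - i.+2)%N ->
  spectators i j (fun x => [ffun t : slot =>
    (wt t == nth ord0 (u0 ++ [:: ord0, ord0 & v0]) x)%:R]) u v =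
  (u == u0)%:R * (v == v0)%:R.
Proof.
move=> ij u0i v0r ui vr; rewrite /spectators.
under eq_bigr do rewrite ffunE wt_rep.
have im := ltn_ord j; rewrite ij in im.
rewrite big_mkcond /=.
rewrite (eq_bigr (fun x => ((x != i) && (x != j) ==> (nth ord0 (u ++ [:: ord0, ord0 & v]) x ==
  nth ord0 (u0 ++ [:: ord0, ord0 & v0]) x))%:R)) => [|x _]; last by case: ifP.
rewrite prod_bool -natrM mulnb; congr ((nat_of_bool _)%:R).
apply/forallP/andP => [uv|[/eqP-> /eqP->] x]; last by rewrite eqxx implybT.
have uvE k : (k < m)%N -> k != i :> nat -> k != i.+1 ->
    nth ord0 (u ++ [:: ord0, ord0 & v]) k = nth ord0 (u0 ++ [:: ord0, ord0 & v0]) k.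
  move=> km ki kj; have /implyP uvk := uv (Ordinal km).
  by apply/eqP/uvk; rewrite -!val_eqE [val j]ij; apply/andP; split.
split; apply/eqP; apply: (@eq_from_nth _ ord0); rewrite ?u0i ?v0r //.
  move=> k; rewrite ui => ki; have := uvE k.
  rewrite !nth_cat ui u0i ki => -> //; first by rewrite (ltn_trans ki) // ltnW.
    by rewrite ltn_eqF.
  by rewrite ltn_eqF // ltnS ltnW.
move=> k; rewrite vr => kr; have := uvE (i + k.+2)%N.
rewrite !nth_cat ui u0i addKn (_ : (i + k.+2 < i)%N = false); last by lia.
by apply; lia.
Qed.

(** Testing against delta placed among weight indicators isolates a single contraction, up to the
    nonzero squared norms of the surrounding words. *)
Lemma isE_coords m (x : sp R (pos n m)) : E x -> isE (coords x).
Proof.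
move=> [Lx Kx] u v; case: (eqVneq (size u + (size v).+2)%N m) => [uvm|uvm]; last first.
  by rewrite big1 // => a _; rewrite /coords size_cat /= (negbTE uvm) mulr0.
have im : (size u < m)%N by rewrite -uvm -addSnnS leq_addr.
have jm : ((size u).+1 < m)%N by rewrite -uvm -!addSnnS leq_addr.
pose i := Ordinal im; pose j := Ordinal jm.
pose vs (x : 'I_m) : sp R 'I_n := [ffun t : slot =>
    (wt t == nth ord0 (u ++ [:: ord0, ord0 & v]) x)%:R].
have Lvs y : Ln (vs y) by exact: (Ln_fun (fun a => (a == nth _ _ y)%:R)).
have vr : size v = (m - i.+2)%N by move: uvm => /=; clear; lia.
have := Kx (ins2 i j (scl 1 (J 2 cup1)) vs).
rewrite -{1}(J_coords Lx) dot_ins2 // => K0.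
have {K0} : wsum (K := K) i (fun u' => (u' == u)%:R * wsum (K := K) (m - i.+2) (fun v' =>
   (v' == v)%:R * (wmass K u' * wmass K v' * \sum_a s a * coords x (u' ++ [:: a, bar a & v'])))) = 0.
  rewrite -[RHS]K0.
    apply: wsum_ext => u' u'i; rewrite -wsumZ; apply: wsum_ext => v' v'r.
    by rewrite spectators_indic // mul1r rmorphM /= !conjC_nat; ring.
  apply: inspan1; exists i, j, (scl 1 (J 2 cup1)), vs; split=> //.
  rewrite (_ : scl 1 _ = J 2 cup1); first exact: detL_cup1.
  by apply/ffunP => t; rewrite ffunE mul1r.
rewrite (@wsum_pick _ _ _ u) // (@wsum_pick _ _ _ v) //.
have wmass0 w : wmass K w != 0.
  by rewrite /wmass prodf_seq_neq0; apply/allP => a _; exact: mass_neq0.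
by move/eqP; rewrite mulf_eq0 mulf_eq0 !(negbTE (wmass0 _)) => /eqP.
Qed.

End SubproductModel.

(** * The isometric embeddings of the summands *)

Section Fusion.
Variables (R : realType) (n : nat).
Hypothesis n_gt0 : (0 < n)%N.
Local Notation C := (complex R).
Local Notation K := (complex R : numClosedFieldType).
Local Notation I := 'I_n.+1.
Local Notation tensor := (seq I -> C).
Local Notation bitensor := (seq I -> seq I -> C).
Implicit Types (a b d : I) (u v w : seq I) (X Y W : bitensor) (f h : tensor).
Implicit Type g : 'M[C]_2.

Lemma isE_rev f : isE (K := K) f -> isE (K := K) (fun u => f (rev u)).
Proof.
move=> Ef; have [[/(_ [::]) El _] _] := is_top_unflat Ef.
by rewrite (_ : (fun u => _) = (unflat f)^~ [::]) //; apply/funext => u; rewrite /unflat cats0.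
Qed.

Lemma EE_J2 k l (x : sp R (pos n k + pos n l)%type) :
  @EE R n k l x -> exists X, isE2 (K := K) X /\ x = J2 k l X.
Proof.
move: x; apply: inspan_closed => [|c _ _ [X [EX ->]] [Y [EY ->]]|_ [u [v [Eu Ev ->]]]].
- by exists (fun _ _ => 0); split; [split=> ?; exact: isE0|exact: J20].
- by exists (fun u v => c * X u v + Y u v); split; [exact: isE2_lin|exact: J2_lin].
exists (fun w1 w2 => coords u (rev w1) * coords v w2); split.
  split=> [w|w]; last by apply: isEZ; exact: isE_coords.
  rewrite (_ : (fun w' => _) = fun w' => coords v w * coords u (rev w')).
    by apply/isEZ/isE_rev/isE_coords.
  by apply/funext => w'; rewrite mulrC.
rewrite -[in LHS](J_coords Eu.1) -[in LHS](J_coords Ev.1).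
by apply/ffunP => t; rewrite !ffunE revK.
Qed.

Definition spell k (w : {ffun 'I_k -> I}) := [seq w i | i <- enum 'I_k].

Lemma jw_expand k f u : size u = k ->
  jw (K := K) f u = \sum_(w : {ffun 'I_k -> I}) f (spell w) * jw (K := K) (fun v => (v == spell w)%:R) u.
Proof.
move=> uk; under eq_bigr do rewrite -jwZ.
rewrite -jw_sum; apply: jw_ext => v; rewrite uk => vk.
pose w0 := [ffun i : 'I_k => nth ord0 v i].
have w0E : spell w0 = v.
  apply: (@eq_from_nth _ ord0); rewrite size_map size_enum_ord ?vk // => i ik.
  by rewrite (nth_map (Ordinal ik)) ?size_enum_ord // ffunE nth_enum_ord.
rewrite (bigD1 w0) //= w0E eqxx mulr1 big1 ?addr0 // => w ww0.
case: eqP => [vE|_]; last by rewrite mulr0.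
case/negP: ww0; apply/eqP/ffunP => i; rewrite ffunE vE.
by rewrite (nth_map i) ?size_enum_ord // nth_ord_enum.
Qed.

(** X equals its own projection; projecting its expansion in pairs of basis words displays it as a
    combination of elementary tensors from E_k and E_l. *)
Lemma J2_EE k l X : isE2 (K := K) X -> @EE R n k l (J2 k l X).
Proof.
move=> EX; pose e m (w : {ffun 'I_m -> I}) : tensor := jw (K := K) (fun v => (v == spell w)%:R).
pose y (p : {ffun 'I_k -> I} * {ffun 'I_l -> I}) :=
  tens (J k (fun w => e k p.1 (rev w))) (J l (e l p.2)).
rewrite (_ : J2 k l X = \sum_p scl (X (spell p.1) (spell p.2)) (y p)).
  apply: inspan_sum => p; exists (J k (fun w => e k p.1 (rev w))), (J l (e l p.2)).
  by split=> //; apply: E_J; [apply: isE_rev|]; exact: isE_jw.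
apply/ffunP => t; rewrite sum_ffunE ffunE -[in LHS](jw2_id n_gt0 EX) /jw2.
rewrite (@jw_expand k) ?size_rev ?size_word //.
transitivity (\sum_(w1 : {ffun 'I_k -> I}) \sum_(w2 : {ffun 'I_l -> I})
    scl (X (spell w1) (spell w2)) (y (w1, w2)) t).
  apply: eq_bigr => w1 _; rewrite (@jw_expand l) ?size_word // mulr_suml.
  apply: eq_bigr => w2 _; rewrite !ffunE -mulrA; congr (_ * _).
  by rewrite mulrC.
by rewrite pair_bigA; apply: eq_bigr => -[].
Qed.

Lemma tower_ext j k l X Y : (j <= k)%N -> (j <= l)%N ->
  (forall u v, size u = (k - j)%N -> size v = (l - j)%N -> X u v = Y u v) ->
  forall u v, size u = k -> size v = l -> tower (K := K) X j u v = tower Y j u v.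
Proof.
elim: j k l => [|j IH] k l; first by rewrite !subn0.
by case: k l => [//|k] [//|l] jk jl XY; apply: raise_ext; apply: IH.
Qed.

Lemma dot2_unflat k l f h :
  dot2 (K := K) k l (unflat f) (unflat h) = wdot (K := K) (k + l) f h.
Proof.
rewrite /wdot wsum_cat -wsum_rev; apply: wsum_ext => u _.
rewrite /wdot -wsumZ; apply: wsum_ext => v _.
by rewrite /unflat wmass_cat wmass_rev !mulrA.
Qed.

Lemma E_lin m c (z z' : sp R (pos n m)) : E z -> E z' -> E (scl c z + z').
Proof.
move=> Ez Ez'; rewrite -(J_coords Ez.1) -(J_coords Ez'.1) J_lin.
by apply: E_J; apply: isE_lin; exact: isE_coords.
Qed.

Lemma EE_lin k l c x y : @EE R n k l x -> @EE R n k l y -> EE (scl c x + y).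
Proof.
move=> /EE_J2[X [EX ->]] /EE_J2[Y [EY ->]]; rewrite J2_lin.
by apply: J2_EE; exact: isE2_lin.
Qed.

Lemma EE_sum k l (T : Type) (r : seq T) (y : T -> sp R (pos n k + pos n l)%type) :
  (forall i, EE (y i)) -> EE (\sum_(i <- r) y i).
Proof.
move=> Ey; elim: r => [|i r IH].
  by rewrite big_nil J20; apply: J2_EE; split=> ?; exact: isE0.
rewrite big_cons (_ : y i = scl 1 (y i)); first exact: EE_lin.
by apply/ffunP => t; rewrite ffunE mul1r.
Qed.

Lemma act_coords g m (z : sp R (pos n m)) : Lpow z ->
  coords (tact g z) = act (K := K) (weight_mx g) (coords z).
Proof.
move=> Lz; rewrite -{1}(J_coords Lz) tact_J; apply/funext => w; rewrite coords_J.
case: eqP => // wm; rewrite -[LHS](act0 (K := K) (weight_mx g) w).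
by apply: act_ext => v vw; rewrite /coords vw; case: eqP.
Qed.

Lemma E_tact m g (z : sp R (pos n m)) : SU2 g -> E z -> E (tact g z).
Proof.
move=> [_ g1] Ez; rewrite -(J_coords Ez.1) tact_J; apply: E_J.
apply: isE_act => //; last exact: isE_coords.
- by move=> b d; exact: weight_cap.
- by move=> a d; exact: weight_cup.
Qed.

Definition emb k l j (z : sp R (pos n (k + l - 2 * j))) : sp R (pos n k + pos n l)%type :=
  scl (sqrtC (nrm K n j k l : K))^-1 (J2 k l (tower (K := K) (unflat (coords z)) j)).

Lemma sqrt_nrm j k l : sqrtC (nrm K n j k l) != 0.
Proof. by rewrite sqrtC_eq0 gt_eqF ?nrm_gt0. Qed.

Lemma emb_lin k l j c z z' : @emb k l j (scl c z + z') = scl c (emb z) + emb z'.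
Proof.
apply/ffunP => t; rewrite !ffunE.
rewrite (_ : coords _ = fun w => c * coords z w + coords z' w).
  by rewrite (tower_lin c (unflat (coords z)) (unflat (coords z'))) mulrDr mulrCA.
apply/funext => w; rewrite /coords; case: ifP => _; last by rewrite mulr0 addr0.
by rewrite !ffunE.
Qed.

Lemma EE_emb k l j z : E z -> EE (@emb k l j z).
Proof.
move=> Ez; rewrite -[emb z]addr0 J20 /emb J2_lin; apply: J2_EE.
apply: isE2_lin; last by split=> ?; exact: isE0.
apply: isE2_tower => //; exact: (is_top_unflat (isE_coords Ez)).1.
Qed.

Lemma tact_emb k l j g z : SU2 g -> E z -> tact g (@emb k l j z) = emb (tact g z).
Proof.
move=> [_ g1] Ez; rewrite /emb tact_scl tact_J2 (act_coords _ Ez.1) -act2_unflat.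
congr (scl _ (J2 _ _ _)); apply/funext => u; apply/funext => v.
rewrite tower_act2 //.
- by move=> b d; exact: weight_cap.
- by move=> a d; exact: weight_cup.
Qed.

Lemma dot_scl (A : finType) (c d : C) (x y : sp R A) :
  dot (scl c x) (scl d y) = c * d^* * dot x y.
Proof. by rewrite -[scl c x]addr0 -[scl d y]addr0 dot_linl dotl0 dot_linr dotr0 !addr0 mulrA. Qed.

Lemma dot_emb k l j z z' : (j <= k)%N -> (j <= l)%N -> E z -> E z' ->
  dot (@emb k l j z) (emb z') = dot z z'.
Proof.
move=> jk jl Ez Ez'; have [Tz Tz'] := (is_top_unflat (isE_coords Ez), is_top_unflat (isE_coords Ez')).
rewrite /emb dot_scl dot_J2 dot2_tower // dot2_unflat mulrA.
rewrite (_ : (k - j + (l - j))%N = (k + l - 2 * j)%N); last by lia.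
rewrite -dot_J !J_coords; [|exact: Ez'.1|exact: Ez.1].
rewrite conj_Creal; last by rewrite ger0_real // invr_ge0 sqrtC_ge0 ltW ?nrm_gt0.
set r := sqrtC _; rewrite (_ : nrm K n j k l = r * r); last by rewrite -expr2 sqrtCK.
rewrite -[RHS]mul1r; congr (_ * _).
by rewrite mulrACA mulVf ?mulr1 ?sqrt_nrm.
Qed.

Lemma dot_emb_neq k l i j z z' : i != j -> (i <= k)%N -> (i <= l)%N ->
  (j <= k)%N -> (j <= l)%N -> E z -> E z' ->
  dot (@emb k l i z) (@emb k l j z') = 0.
Proof.
move=> ij ik il jk jl Ez Ez'.
have [Tz Tz'] := (is_top_unflat (isE_coords Ez), is_top_unflat (isE_coords Ez')).
by rewrite /emb dot_scl dot_J2 dot2_tower_neq ?mulr0.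
Qed.

Local Notation family k l := (forall j : 'I_(minn k l).+1, sp R (pos n (k + l - 2 * j))).

Lemma ord_minn k l (j : 'I_(minn k l).+1) : (j <= k)%N /\ (j <= l)%N.
Proof. by apply/andP; rewrite -leq_min -ltnS. Qed.

Lemma dot_sum_emb k l (z z' : family k l) : (forall j, E (z j)) -> (forall j, E (z' j)) ->
  dot (\sum_j emb (z j)) (\sum_j emb (z' j)) = \sum_j dot (z j) (z' j).
Proof.
move=> Ez Ez'; rewrite dot_suml; apply: eq_bigr => j _; rewrite dot_sumr.
have [jk jl] := ord_minn j.
rewrite (bigD1 j) //= dot_emb // big1 ?addr0 // => i ij.
by have [ik il] := ord_minn i; rewrite dot_emb_neq // eq_sym.
Qed.

Lemma sum_emb_lin k l c (z z' : family k l) :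
  \sum_j emb (scl c (z j) + z' j) = scl c (\sum_j emb (z j)) + \sum_j emb (z' j).
Proof.
under eq_bigr do rewrite emb_lin.
rewrite big_split; congr (_ + _); apply/ffunP => t.
by rewrite ffunE !sum_ffunE mulr_sumr; apply: eq_bigr => j _; rewrite ffunE.
Qed.

(** The sum of the embeddings is isometric, so the squared norms of the differences add up to 0. *)
Lemma sum_emb_inj k l (z z' : family k l) : (forall j, E (z j)) -> (forall j, E (z' j)) ->
  \sum_j emb (z j) = \sum_j emb (z' j) -> forall j, z j = z' j.
Proof.
move=> Ez Ez' zz' j; pose d i := scl (-1) (z' i) + z i.
have Ed i : E (d i) by exact: E_lin.
have := dot_sum_emb Ed Ed; rewrite sum_emb_lin zz'.
rewrite (_ : scl _ _ + _ = 0); last by apply/ffunP => t; rewrite !ffunE mulN1r addNr.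
rewrite dotr0 => /esym/eqP; rewrite psumr_eq0 => [|i _]; last exact: dot_ge0.
move=> /allP/(_ j (mem_index_enum j))/eqP/dot_eq0/ffunP dj.
by apply/ffunP => t; have := dj t; rewrite !ffunE mulN1r => /eqP; rewrite addrC subr_eq0 => /eqP.
Qed.

Lemma sum_emb_surj k l x : @EE R n k l x ->
  exists z : family k l, (forall j, E (z j)) /\ x = \sum_j emb (z j).
Proof.
move=> /EE_J2[X [EX ->]]; have [f [Ef fE]] := decomposition n_gt0 k l EX.
(* The square root compensates the normalisation in [emb]. *)
exists (fun j : 'I_(minn k l).+1 => J (k + l - 2 * j) (fun w => sqrtC (nrm K n j k l) * f j w)); split=> [j|].
  by apply: E_J; exact: isEZ.
apply/ffunP => t; rewrite sum_ffunE ffunE fE ?size_rev ?size_word //.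
apply: eq_bigr => j _; rewrite !ffunE; have [jk jl] := ord_minn j.
rewrite [in RHS](@tower_ext j k l _ (fun u v => sqrtC (nrm K n j k l) * unflat (f j) u v)) //.
- by rewrite towerZ mulrA mulVf ?mul1r ?sqrt_nrm.
- move=> u v uk vl; rewrite /unflat coords_J size_cat size_rev uk vl.
  by rewrite ifT //; apply/eqP; lia.
- by rewrite size_rev size_word.
- by rewrite size_word.
Qed.

End Fusion.

(* An SU(2)-equivariant unitary isomorphism
     E_k (x) E_l  ~=  E_{k+l} (+) E_{k+l-2} (+) ... (+) E_{|k-l|}
   given by its components T j : E_k (x) E_l -> E_{k+l-2j}, j = 0..min(k,l). *)
Theorem theorem3p1 (R : realType) (n k l : nat) : (0 < n)%N ->
  exists T : forall j : 'I_(minn k l).+1,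
      sp R (pos n k + pos n l)%type -> sp R (pos n (k + l - 2 * j)),
  [/\ (* linear *)
      forall j c x y, @EE R n k l x -> @EE R n k l y ->
        T j (scl c x + y) = scl c (T j x) + T j y,
      (* lands in E_{k+l-2j} *)
      forall j x, @EE R n k l x -> @E R n _ (T j x),
      (* SU(2)-equivariant (diagonal action on E_k (x) E_l) *)
      forall j g x, SU2 g -> @EE R n k l x -> T j (tact g x) = tact g (T j x),
      (* isometric onto the orthogonal direct sum *)
      forall x y, @EE R n k l x -> @EE R n k l y ->
        \sum_(j < (minn k l).+1) dot (T j x) (T j y) = dot x y
    & (* surjective *)
      forall z : forall j : 'I_(minn k l).+1, sp R (pos n (k + l - 2 * j)),
        (forall j, @E R n _ (z j)) ->
        exists x, @EE R n k l x /\ forall j, T j x = z j].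
Proof.
move=> n_gt0.
(* T is the inverse of the sum of the embeddings, made a total function by choice; outside E_k (x)
   E_l the family 0 is a default. *)
have ex_z x : exists z : forall j : 'I_(minn k l).+1, sp R (pos n (k + l - 2 * j)),
    @EE R n k l x -> (forall j, E (z j)) /\ x = \sum_j emb (z j).
  have [/(sum_emb_surj n_gt0)[z zE]|nEx] := pselect (@EE R n k l x); first by exists z.
  by exists (fun=> 0).
have [S SP] := choice ex_z.
have ES x : @EE R n k l x -> forall j, E (S x j) by move=> /SP[].
have xE x : @EE R n k l x -> x = \sum_j emb (S x j) by move=> /SP[].
have EE_fam (z : forall j : 'I_(minn k l).+1, sp R (pos n (k + l - 2 * j))) :
    (forall j, E (z j)) -> EE (\sum_j emb (z j)).
  by move=> Ez; apply: EE_sum => // j; exact: EE_emb.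
(* Uniqueness of the components: through it, linearity and equivariance pass from the embeddings to
   their inverse. *)
have SE (z : forall j : 'I_(minn k l).+1, sp R (pos n (k + l - 2 * j))) :
    (forall j, E (z j)) -> forall j, S (\sum_j emb (z j)) j = z j.
  move=> Ez; apply: (sum_emb_inj n_gt0) => //; first exact/ES/EE_fam.
  by rewrite -xE //; exact: EE_fam.
exists (fun j x => S x j); split.
- move=> j c x y Ex Ey; rewrite {1}(xE x Ex) {1}(xE y Ey) -sum_emb_lin SE // => i.
  by apply: E_lin; exact: ES.
- by move=> j x Ex; exact: ES.
- move=> j g x Sg Ex; rewrite {1}(xE x Ex) tact_sum_sp.
  under eq_bigr => i _ do rewrite (tact_emb Sg (ES x Ex i)).
  by rewrite SE // => i; apply: E_tact => //; exact: ES.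
- by move=> x y Ex Ey; rewrite {2}(xE x Ex) {2}(xE y Ey) dot_sum_emb //; exact: ES.
- by move=> z Ez; exists (\sum_j emb (z j)); split; [exact: EE_fam|exact: SE].
Qed.
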